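(* Let $\delta>0$. Let $x,y$ be strings of length $n$, with full (random) access to $y$ and one-pass streaming access to $x$. There is a deterministic one-pass streaming algorithm that computes a $(1+\delta)$-approximation to $E(x,y)$ (a value in $[E(x,y),(1+\delta)E(x,y)]$) using $O(\sqrt{(n\ln n)/\delta})$ space. The algorithm performs $O(\sqrt{(\delta n)/\ln n})$ updates, each taking $O(n^2\ln n/\delta)$ time.
   Context: For strings $x,y$ of length $n$, $LCS(x,y)$ is the length of a longest common subsequence and $E(x,y)=n-LCS(x,y)$. Space is counted in memory cells each holding a symbol, an index, or an integer polynomial in $n$. *)

(* Defs.v *)
From mathcomp Require Import all_boot.
Set Implicit Arguments.
Unset Strict Implicit.
Unset Printing Implicit Defensive.

Section EditDistance.
Variable Sigma : eqType.
Implicit Types s x y : seq Sigma.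

(* The subsequences of x are exactly the sequences [mask m x]. *)
Definition LCS x y : nat :=
  \max_(m : (size x).-tuple bool | subseq (mask m x) y) size (mask m x).

Lemma LCS_common x y :
  exists s, [/\ subseq s x, subseq s y & size s = LCS x y].
Proof.
have h0 : subseq (mask [tuple of nseq (size x) false] x) y.
  by rewrite mask_false sub0seq.
rewrite /LCS (bigop.bigmax_eq_arg _ h0).
by case: arg_maxnP => // m hm _; exists (mask m x); rewrite mask_subseq.
Qed.

Lemma LCS_max s x y : subseq s x -> subseq s y -> size s <= LCS x y.
Proof.
move=> /subseqP [m sz_m ->] hy.
pose t := Tuple (introT eqP sz_m).
exact: (@leq_bigmax_cond _ (fun m : (size x).-tuple bool => subseq (mask m x) y)
  (fun m => size (mask m x)) t hy).
Qed.

Definition E n (x y : n.-tuple Sigma) : nat := n - LCS x y.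

End EditDistance.

(* Programs for a random access machine reading the stream x once and having
   random access to the read-only string y.  Programs do not mention the
   alphabet: a symbol can only be copied and compared with another symbol.
   The program counter and the intermediate values of expressions are not
   counted as memory cells: they amount to O(1) cells for a fixed program. *)

Inductive binop := OpAdd | OpSub | OpMul | OpDiv | OpLt | OpEq.

Inductive expr :=
| Const of nat
| Len                        (* the length n of y *)
| Cell of expr               (* content of the memory cell with that address *)
| Query of expr              (* symbol of y at that position, from 0 *)
| Bin of binop & expr & expr.

Inductive cmd :=
| Skip
| Assign of expr & expr      (* address of the target cell, new content *)
| Next of expr               (* move the next symbol of x to that cell *)
| Seq of cmd & cmd
| If of expr & cmd & cmd
| While of expr & cmd.

Inductive value (Sigma : Type) := Int of nat | Sym of Sigma.
Arguments Int {Sigma}.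

(* The time charged for evaluating an expression: one unit per node. *)
Fixpoint ecost (e : expr) : nat :=
  match e with
  | Const _ | Len => 1
  | Cell e | Query e => (ecost e).+1
  | Bin _ e1 e2 => (ecost e1 + ecost e2).+1
  end.

Section Machine.
Variable Sigma : eqType.

(* W bounds the integers that can be handled, including intermediate results:
   any overflow is an error. *)
Variables (y : seq Sigma) (W : nat).

Local Notation value := (value Sigma).

(* The memory has size m cells; accessing any other cell is an error. *)
Implicit Types (m : seq value) (x : seq Sigma).

Definition word (k : nat) : option value :=
  if k <= W then Some (Int k) else None.

(* Subtraction is truncated at 0, and division is Euclidean, with i / 0 = 0. *)
Definition apply (o : binop) (u v : value) : option value :=
  match o, u, v with
  | OpAdd, Int i, Int j => word (i + j)
  | OpSub, Int i, Int j => word (i - j)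
  | OpMul, Int i, Int j => word (i * j)
  | OpDiv, Int i, Int j => word (i %/ j)
  | OpLt, Int i, Int j => word (i < j)
  | OpEq, Int i, Int j => word (i == j)
  | OpEq, Sym a, Sym b => word (a == b)
  | _, _, _ => None
  end.

Fixpoint eval m (e : expr) : option value :=
  match e with
  | Const k => word k
  | Len => word (size y)
  | Cell e => if eval m e is Some (Int i) then onth m i else None
  | Query e => if eval m e is Some (Int i) then omap (@Sym Sigma) (onth y i)
               else None
  | Bin o e1 e2 => match eval m e1, eval m e2 with
                   | Some u, Some v => apply o u v
                   | _, _ => None
                   end
  end.

(* [exec c m x t m' x']: started in memory m with x the unread part of the
   stream, c terminates without error in time t, leaving memory m' and unread
   stream x'. *)
Inductive exec : cmd -> seq value -> seq Sigma -> nat ->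
                 seq value -> seq Sigma -> Prop :=
| ExecSkip m x : exec Skip m x 1 m x
| ExecAssign a e m x i v of
    eval m a = Some (Int i) & i < size m & eval m e = Some v :
    exec (Assign a e) m x (ecost a + ecost e).+1 (set_nth (Int 0) m i v) x
| ExecNext a m x s i of eval m a = Some (Int i) & i < size m :
    exec (Next a) m (s :: x) (ecost a).+1 (set_nth (Int 0) m i (Sym s)) x
| ExecSeq c1 c2 m1 x1 t1 m2 x2 t2 m3 x3 of
    exec c1 m1 x1 t1 m2 x2 & exec c2 m2 x2 t2 m3 x3 :
    exec (Seq c1 c2) m1 x1 (t1 + t2) m3 x3
| ExecIf e c1 c2 k m x t m' x' of
    eval m e = Some (Int k) & exec (if k != 0 then c1 else c2) m x t m' x' :
    exec (If e c1 c2) m x (ecost e + t).+1 m' x'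
| ExecWhileEnd e c m x of eval m e = Some (Int 0) :
    exec (While e c) m x (ecost e).+1 m x
| ExecWhileStep e c k m1 x1 t1 m2 x2 t2 m3 x3 of
    eval m1 e = Some (Int k.+1) & exec c m1 x1 t1 m2 x2 &
    exec (While e c) m2 x2 t2 m3 x3 :
    exec (While e c) m1 x1 (ecost e + t1 + t2).+1 m3 x3.

(* A streaming algorithm is given by the program [upd] of one update, which
   reads a portion of the stream; updates are performed until the stream is
   exhausted.  [run upd m x ts m']: this ends with memory m', and ts lists the
   times taken by the successive updates.  No work is done outside updates. *)
Inductive run (upd : cmd) : seq value -> seq Sigma -> seq nat ->
                            seq value -> Prop :=
| RunEnd m : run upd m [::] [::] m
| RunUpdate m1 x1 t m2 x2 ts m3 of
    x1 <> [::] & exec upd m1 x1 t m2 x2 & run upd m2 x2 ts m3 :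
    run upd m1 x1 (t :: ts) m3.

(* The output v is found in cell 0 at the end of the run; all S cells initially
   contain 0. *)
Definition computes (upd : cmd) (S : nat) (x : seq Sigma) (ts : seq nat)
    (v : nat) : Prop :=
  exists2 m, run upd (nseq S (Int 0)) x ts m & onth m 0 = Some (Int v).

Lemma exec_det c m x t1 m1 x1 t2 m2 x2 :
  exec c m x t1 m1 x1 -> exec c m x t2 m2 x2 -> [/\ t1 = t2, m1 = m2 & x1 = x2].
Proof.
move=> h; elim: h t2 m2 x2 => {c m x t1 m1 x1}.
- by move=> m x t m' x' h; inversion h.
- by move=> a e m x i v ha _ he t m' x' h; inversion h; subst; split; congruence.
- by move=> a m x s i ha _ t m' x' h; inversion h; subst; split; congruence.
- move=> c1 c2 m1 x1 t1 m2 x2 t2 m3 x3 _ IH1 _ IH2 t m' x' h; inversion h; subst.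
  by case: (IH1 _ _ _ ltac:(eassumption)) => ? ? ?; subst;
     case: (IH2 _ _ _ ltac:(eassumption)) => ? ? ?; subst.
- move=> e c1 c2 k m x t m' x' he _ IH t2 m2 x2 h; inversion h; subst.
  have ek : k0 = k by congruence.
  by subst; case: (IH _ _ _ ltac:(eassumption)) => ? ? ?; subst.
- by move=> e c m x he t m' x' h; inversion h; subst; split=> //; congruence.
- move=> e c k m1 x1 t1 m2 x2 t2 m3 x3 he _ IH1 _ IH2 t m' x' h.
  inversion h; subst; first by congruence.
  by case: (IH1 _ _ _ ltac:(eassumption)) => ? ? ?; subst;
     case: (IH2 _ _ _ ltac:(eassumption)) => ? ? ?; subst.
Qed.

Lemma computes_det upd S x ts1 v1 ts2 v2 :
  computes upd S x ts1 v1 -> computes upd S x ts2 v2 -> ts1 = ts2 /\ v1 = v2.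
Proof.
move=> [m1 h1 o1] [m2 h2 o2].
suff [e1 e2] : ts1 = ts2 /\ m1 = m2 by split=> //; congruence.
move: h2 => {o1 o2}; elim: h1 ts2 m2 => {m1 x ts1}.
  by move=> m ts2 m2 h; inversion h.
move=> m1 x1 t m2 x2 ts m3 nx h _ IH ts2 m4 h2.
inversion h2; subst=> //; move/exec_det: h => det.
by case: (det _ _ _ ltac:(eassumption)) => ? ? ?; subst;
   case: (IH _ _ ltac:(eassumption)) => ? ?; subst.
Qed.

End Machine.

(* Main.v *)
(** Each update reads a block of b ~ sqrt(n ln n / delta) symbols of x.  After
    the first i symbols, the program knows values U(j) <= L(i,j), where L(i,j)
    is the LCS of the prefixes of x and y of lengths i and j.  One pass of the
    LCS recurrence, started from the row U and restricted to the new block,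
    gives values V(j) <= L(i',j) for i' = i + block length; these are stored
    only for j = i' + s_t and j = i' - s_t, where s_(t+1) = s_t + 1 + s_t %/ q
    takes about q ln n values below n, and are interpolated by
    U'(j) = max_g (V(g) - (g - j)^+).

    The error is measured against the indel distance c(i,j) = i + j - 2 L(i,j):
    after k blocks, L(i,j) - U(j) <= (k / q) c(i,j).  The recurrence preserves
    this cell by cell, because c never decreases along a step of the recurrence,
    and rounding j up to a stored position g costs g - j <= |i' - j| / q
    <= c(i',j) / q.  At the end c(n,n) = 2 E and k <= n/b + 1, so that
    q >= 2 (n/b + 1) / delta makes the error at most delta E: errors add up and
    do not compound. *)
Require Import Defs.
From mathcomp Require Import all_boot all_order all_algebra.
From mathcomp Require Import reals exp.
From mathcomp Require Import zify lra ring.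
Set Implicit Arguments.
Unset Strict Implicit.
Unset Printing Implicit Defensive.

(** * Longest common subsequences of prefixes *)

Section LCSTheory.
Variable Sigma : eqType.
Implicit Types (s x y : seq Sigma) (a b : Sigma).

Lemma leq_LCS x x' y y' : subseq x x' -> subseq y y' -> LCS x y <= LCS x' y'.
Proof.
move=> sx sy; have [s [s_x s_y <-]] := LCS_common x y.
by apply: LCS_max; [exact: subseq_trans s_x sx | exact: subseq_trans s_y sy].
Qed.

Lemma LCS_sizel x y : LCS x y <= size x.
Proof. by have [s [s_x _ <-]] := LCS_common x y; apply: size_subseq. Qed.

Lemma LCS_sizer x y : LCS x y <= size y.
Proof. by have [s [_ s_y <-]] := LCS_common x y; apply: size_subseq. Qed.

(** Mirror image of the equation of [subseq] on two conses, obtained by reversing both sequences. *)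
Lemma subseq_rconsE s x a b :
  subseq (rcons s a) (rcons x b) = subseq (if a == b then s else rcons s a) x.
Proof.
rewrite -subseq_rev !rev_rcons /=; case: eqP => _; first exact: subseq_rev.
by rewrite -rev_rcons subseq_rev.
Qed.

Lemma LCS_rcons_match x y a : LCS x y < LCS (rcons x a) (rcons y a).
Proof.
have [s [s_x s_y <-]] := LCS_common x y; rewrite -(size_rcons s a).
by apply: LCS_max; rewrite subseq_rconsE eqxx.
Qed.

Lemma LCS_rconsr x y b : LCS x (rcons y b) <= (LCS x y).+1.
Proof.
have [s [+ + <-]] := LCS_common x (rcons y b).
case/lastP: s => // s c s_x; rewrite subseq_rconsE size_rcons ltnS.
have s_xs : subseq s x by apply: subseq_trans s_x; apply: subseq_rcons.
case: eqP => _ s_y; first exact: LCS_max.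
by apply: LCS_max => //; apply: subseq_trans s_y; apply: subseq_rcons.
Qed.

(** Look at the last symbol c of an optimal common subsequence: if c differs from b or from a, the
    corresponding last symbol is never matched; otherwise a = b and dropping c leaves a common
    subsequence of x and y. *)
Lemma LCS_rcons_le x y a b :
  LCS (rcons x a) (rcons y b) <=
  maxn (maxn (LCS (rcons x a) y) (LCS x (rcons y b))) (LCS x y + (a == b)).
Proof.
have [s [+ + <-]] := LCS_common (rcons x a) (rcons y b).
case/lastP: s => // s c s_x s_y; rewrite !leq_max.
have := s_x; rewrite subseq_rconsE; have := s_y; rewrite subseq_rconsE.
case: (eqVneq c b) => [eb sy|_ sy]; last first.
  by rewrite [X in (X || _) || _](LCS_max s_x sy).
case: (eqVneq c a) => [ea sx|_ sx]; last first.
  by rewrite [X in (_ || X) || _](LCS_max sx s_y) orbT.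
by rewrite -ea -eb eqxx addn1 size_rcons ltnS (LCS_max sx sy) orbT.
Qed.

End LCSTheory.

(** * Programs over scalars and arrays *)

(* [IMatch i j] compares the i-th stored symbol with the j-th symbol of y. *)
Inductive iexp :=
| IC of nat | IL | IV of nat | IA of nat & iexp
| IOp of binop & iexp & iexp | IMatch of iexp & iexp.

(* Scalars occupy the first [nscal] cells; the arrays are interleaved after
   them, entry i of array r being in cell [nscal + r + narr * i].  Array 0
   holds symbols. *)
Definition nscal := 14.
Definition narr := 6.

Definition addr r e :=
  Bin OpAdd (Const (nscal + r)) (Bin OpMul (Const narr) e).

Fixpoint compile e :=
  match e with
  | IC k => Const k
  | IL => Len
  | IV r => Cell (Const r)
  | IA r e => Cell (addr r.+1 (compile e))
  | IOp o e1 e2 => Bin o (compile e1) (compile e2)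
  | IMatch e1 e2 => Bin OpEq (Cell (addr 0 (compile e1))) (Query (compile e2))
  end.

Definition natop o i j :=
  match o with
  | OpAdd => i + j
  | OpSub => i - j
  | OpMul => i * j
  | OpDiv => i %/ j
  | OpLt => i < j : nat
  | OpEq => i == j : nat
  end.

Definition fupd T (f : nat -> T) i v : nat -> T :=
  fun k => if k == i then v else f k.

Definition SetV r e := Assign (Const r) (compile e).
Definition SetA r ei e := Assign (addr r.+1 (compile ei)) (compile e).
Definition Read ei := Next (addr 0 (compile ei)).
Definition For r bound c :=
  Seq (SetV r (IC 0))
      (While (compile (IOp OpLt (IV r) bound))
             (Seq c (SetV r (IOp OpAdd (IV r) (IC 1))))).

Lemma onth_lt T (s : seq T) i x0 : i < size s -> onth s i = Some (nth x0 s i).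
Proof. by move=> lt_i; rewrite onthE (nth_map x0). Qed.

Section Programs.
Variables (Sigma : eqType) (y : seq Sigma) (W M : nat).
Hypothesis le_memW : nscal + narr * M <= W.
Hypothesis le_yW : size y < W.

(** An abstract view of the memory in which arrays are total functions; [memory] realises only their
    first M entries. *)
Record state :=
  St { vs : seq nat; ar : seq (nat -> nat); blk : nat -> value Sigma }.

Implicit Types (st : state) (e : iexp) (x : seq Sigma).

Definition contents st a : value Sigma :=
  if a < nscal then Int (nth 0 (vs st) a)
  else if (a - nscal) %% narr is r.+1
       then Int (nth (fun=> 0) (ar st) r ((a - nscal) %/ narr))
       else blk st ((a - nscal) %/ narr).

Definition memory st := mkseq (contents st) (nscal + narr * M).

Definition setv st r k := St (set_nth 0 (vs st) r k) (ar st) (blk st).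
Definition seta st r i k :=
  St (vs st)
     (set_nth (fun=> 0) (ar st) r (fupd (nth (fun=> 0) (ar st) r) i k)) (blk st).
Definition setb st i v := St (vs st) (ar st) (fupd (blk st) i v).

Fixpoint sem st e :=
  match e with
  | IC k => k
  | IL => size y
  | IV r => nth 0 (vs st) r
  | IA r e => nth (fun=> 0) (ar st) r (sem st e)
  | IOp o e1 e2 => natop o (sem st e1) (sem st e2)
  | IMatch e1 e2 =>
      if blk st (sem st e1) is Sym a then onth y (sem st e2) == Some a : nat
      else 0
  end.

(** The side conditions under which evaluation cannot fail. Values loaded from cells need no bound,
    since overflow is tested only on constants and on results of operations. *)
Fixpoint ok st e : Prop :=
  match e with
  | IC k => k <= W
  | IL => True
  | IV r => r < nscal
  | IA r e => [/\ ok st e, sem st e < M & r.+1 < narr]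
  | IOp o e1 e2 => [/\ ok st e1, ok st e2 & sem st (IOp o e1 e2) <= W]
  | IMatch e1 e2 =>
      [/\ ok st e1, ok st e2, sem st e1 < M,
          (if blk st (sem st e1) is Sym _ then True else False)
        & sem st e2 < size y]
  end.

Lemma word_le k : k <= W -> word Sigma W k = Some (Int k).
Proof. by rewrite /word => ->. Qed.

Lemma onth_mem st a : a < nscal + narr * M -> onth (memory st) a = Some (contents st a).
Proof.
by move=> lt_a; rewrite (onth_lt (Int 0)) ?size_mkseq // nth_mkseq.
Qed.

Lemma addr_lt r i : r < narr -> i < M -> nscal + r + narr * i < nscal + narr * M.
Proof. rewrite /narr /nscal; lia. Qed.

Lemma contents_arr st r i : r < narr ->
  contents st (nscal + r + narr * i) =
  if r is r'.+1 then Int (nth (fun=> 0) (ar st) r' i) else blk st i.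
Proof.
move=> lt_r; rewrite /contents -addnA ltnNge leq_addr /= addKn.
by rewrite addnC mulnC modnMDl divnMDl // modn_small // divn_small // addn0.
Qed.

Lemma eval_addr st r (e : expr) i : r < narr -> i < M ->
  eval y W (memory st) e = Some (Int i) ->
  eval y W (memory st) (addr r e) = Some (Int (nscal + r + narr * i)).
Proof.
move=> lt_r lt_i he; have := addr_lt lt_r lt_i => lt_a.
rewrite /addr /= he !word_le /= ?word_le //; move: le_memW lt_a;
  rewrite /narr /nscal in lt_r *; lia.
Qed.

Lemma eval_comp st e :
  ok st e -> eval y W (memory st) (compile e) = Some (Int (sem st e)).
Proof.
elim: e => [k||r|r e IH|o e1 IH1 e2 IH2|e1 IH1 e2 IH2] /=.
- exact: word_le.
- by move=> _; apply: word_le; apply: ltnW.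
- move=> lt_r; have lt_rm : r < nscal + narr * M by rewrite ltn_addr.
  rewrite word_le ?(leq_trans (ltnW lt_rm)) // onth_mem //.
  by rewrite /contents lt_r.
- case=> /IH he lt_i lt_r.
  have := eval_addr lt_r lt_i he; rewrite /= => ->.
  by rewrite onth_mem ?addr_lt // contents_arr.
- case=> /IH1 -> /IH2 -> le_W.
  by case: o le_W => /= le_W; apply: word_le.
- case=> /IH1 he1 /IH2 he2 lt_i; case eb: blk => [//|a] _ lt_j.
  have := eval_addr (isT : 0 < narr) lt_i he1; rewrite /= => ->.
  rewrite onth_mem ?addr_lt // contents_arr // eb he2.
  rewrite (onth_lt a lt_j) /= word_le ?(inj_eq Some_inj) 1?eq_sym //.
  by rewrite (leq_trans (leq_b1 _)) // (leq_trans _ le_memW).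
Qed.

Lemma mem_setv st r k : r < nscal ->
  memory (setv st r k) = set_nth (Int 0) (memory st) r (Int k).
Proof.
move=> lt_r; have lt_rm : r < nscal + narr * M by rewrite ltn_addr.
apply: (@eq_from_nth _ (Int 0)); first by rewrite size_set_nth !size_mkseq; lia.
move=> a; rewrite size_mkseq => lt_a; rewrite nth_set_nth /= !nth_mkseq //.
rewrite /contents /= nth_set_nth /=; case: eqP => // ->; by rewrite lt_r.
Qed.

Lemma mem_seta st r i k : r.+1 < narr -> i < M ->
  memory (seta st r i k) =
  set_nth (Int 0) (memory st) (nscal + r.+1 + narr * i) (Int k).
Proof.
move=> lt_r lt_i; have lt_rm := addr_lt lt_r lt_i.
apply: (@eq_from_nth _ (Int 0)); first by rewrite size_set_nth !size_mkseq; lia.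
move=> a; rewrite size_mkseq => lt_a; rewrite nth_set_nth /= !nth_mkseq //.
case: eqP => [->|ne_a].
  by rewrite contents_arr // /seta /= nth_set_nth /= eqxx /fupd eqxx.
rewrite /contents; case: ltnP => // le_a; case e: (_ %% _) => [//|r'] /=.
congr Int; rewrite nth_set_nth /=; case: eqP => // er; rewrite er in e *.
rewrite /fupd; case: eqP => // ei; case: ne_a.
by move: e ei le_a; rewrite /nscal /narr; lia.
Qed.

Lemma mem_setb st i v : i < M ->
  memory (setb st i v) = set_nth (Int 0) (memory st) (nscal + 0 + narr * i) v.
Proof.
move=> lt_i; have lt_rm := addr_lt (isT : 0 < narr) lt_i.
apply: (@eq_from_nth _ (Int 0)); first by rewrite size_set_nth !size_mkseq; lia.
move=> a; rewrite size_mkseq => lt_a; rewrite nth_set_nth /= !nth_mkseq //.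
case: eqP => [->|ne_a]; first by rewrite contents_arr //= /fupd eqxx.
rewrite /contents; case: ltnP => // le_a; case e: (_ %% _) => [|//] /=.
rewrite /fupd; case: eqP => // ei; case: ne_a.
by move: e ei le_a; rewrite /nscal /narr; lia.
Qed.

(** Total correctness together with a time bound. Exhibiting one execution is enough because [exec]
    is deterministic. *)
Definition wp c st x T (Q : state -> seq Sigma -> Prop) :=
  exists t st' x', [/\ exec y W c (memory st) x t (memory st') x', t <= T & Q st' x'].

Lemma wp_weaken c st x T T' Q Q' : T <= T' ->
  (forall st x, Q st x -> Q' st x) -> wp c st x T Q -> wp c st x T' Q'.
Proof.
move=> le_T QQ' [t [st' [x' [ex le_t Qst']]]]; exists t, st', x'.
by split=> //; [apply: leq_trans le_t le_T | apply: QQ'].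
Qed.

Lemma wp_seq c1 c2 st x T1 T2 Q :
  wp c1 st x T1 (fun st1 x1 => wp c2 st1 x1 T2 Q) ->
  wp (Seq c1 c2) st x (T1 + T2) Q.
Proof.
move=> [t1 [st1 [x1 [ex1 le_t1 [t2 [st2 [x2 [ex2 le_t2 Qst2]]]]]]]].
by exists (t1 + t2), st2, x2; split=> //; [apply: ExecSeq ex1 ex2 | apply: leq_add].
Qed.

Lemma eval_const st k : k <= W -> eval y W (memory st) (Const k) = Some (Int k).
Proof. exact: word_le. Qed.

Lemma wp_setv r e st x T Q : r < nscal -> ok st e -> ecost (compile e) <= T ->
  Q (setv st r (sem st e)) x -> wp (SetV r e) st x (T + 2) Q.
Proof.
move=> lt_r ok_e le_T Qst; have lt_rm : r < nscal + narr * M by rewrite ltn_addr.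
exists (ecost (Const r) + ecost (compile e)).+1, (setv st r (sem st e)), x.
split=> //; last by rewrite /=; lia.
rewrite mem_setv //; apply: ExecAssign; last exact: eval_comp.
  by apply: eval_const; apply: leq_trans le_memW; apply: ltnW.
by rewrite size_mkseq.
Qed.

Lemma wp_seta r ei e st x T Q : r.+1 < narr -> ok st ei -> sem st ei < M ->
  ok st e -> ecost (compile ei) + ecost (compile e) <= T ->
  Q (seta st r (sem st ei) (sem st e)) x -> wp (SetA r ei e) st x (T + 5) Q.
Proof.
move=> lt_r ok_ei lt_ei ok_e le_T Qst.
exists (ecost (addr r.+1 (compile ei)) + ecost (compile e)).+1,
  (seta st r (sem st ei) (sem st e)), x.
split=> //; last by rewrite /=; lia.
rewrite mem_seta //; apply: ExecAssign; last exact: eval_comp.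
  by apply: eval_addr => //; apply: eval_comp.
by rewrite size_mkseq addr_lt.
Qed.

Lemma wp_read ei st a x T Q : ok st ei -> sem st ei < M ->
  ecost (compile ei) <= T ->
  Q (setb st (sem st ei) (Sym a)) x -> wp (Read ei) st (a :: x) (T + 5) Q.
Proof.
move=> ok_ei lt_ei le_T Qst.
exists (ecost (addr 0 (compile ei))).+1, (setb st (sem st ei) (Sym a)), x.
split=> //; last by rewrite /=; lia.
rewrite mem_setb //; apply: ExecNext.
  by apply: eval_addr => //; apply: eval_comp.
by rewrite size_mkseq addr_lt.
Qed.

(** The bound is evaluated again at every test, so the invariant must fix its value; nb < W keeps
    the counter, which ends at nb, from overflowing. The constants 10 and 15 cover initialisation,
    tests and increments. *)
Lemma wp_for r bound c nb Tb Te (Inv : nat -> state -> seq Sigma -> Prop)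
    st x Q :
  r < nscal -> nb < W -> ecost (compile bound) <= Te ->
  Inv 0 (setv st r 0) x ->
  (forall k st x, k <= nb -> Inv k st x ->
     [/\ nth 0 (vs st) r = k, ok st bound & sem st bound = nb]) ->
  (forall k st x, k < nb -> Inv k st x ->
     wp c st x Tb
       (fun st' x' => nth 0 (vs st') r = k /\ Inv k.+1 (setv st' r k.+1) x')) ->
  (forall st x, Inv nb st x -> Q st x) ->
  wp (For r bound c) st x (Te + 10 + nb * (Tb + Te + 15)) Q.
Proof.
move=> lt_r lt_nb le_Te Inv0 InvE step InvQ.
have -> : Te + 10 + nb * (Tb + Te + 15) =
          1 + 2 + (Te + 7 + nb * (Tb + Te + 15)) by lia.
apply/wp_seq/wp_setv => //=.
have eval_guard k st1 x1 : k <= nb -> Inv k st1 x1 ->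
  eval y W (memory st1) (compile (IOp OpLt (IV r) bound)) = Some (Int (k < nb)).
  move=> le_k /InvE -/(_ le_k)[er okb eb].
  have -> : k < nb = sem st1 (IOp OpLt (IV r) bound) :> nat by rewrite /= er eb.
  by apply: eval_comp; split=> //=; rewrite (leq_trans (leq_b1 _)) // (leq_trans _ lt_nb).
have: Inv (nb - nb) (setv st r 0) x by rewrite subnn.
move: {st Inv0} (setv st r 0) => st.
(* Induction on the number m of iterations left: the counter is nb - m. *)
suff main m st1 x1 : m <= nb -> Inv (nb - m) st1 x1 ->
    wp (While (compile (IOp OpLt (IV r) bound))
              (Seq c (SetV r (IOp OpAdd (IV r) (IC 1)))))
       st1 x1 (Te + 7 + m * (Tb + Te + 15)) Q.
  exact: main (leqnn nb).
elim: m st1 x1 => {x st} [|m IH] st x le_m Inv_st.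
  rewrite subn0 in Inv_st.
  exists (ecost (compile (IOp OpLt (IV r) bound))).+1, st, x.
  split; [|by rewrite /=; lia|exact: InvQ].
  apply: ExecWhileEnd.
  by rewrite (eval_guard _ _ _ (leqnn nb) Inv_st) ltnn.
have lt_k : nb - m.+1 < nb by lia.
have [er okb eb] := InvE _ _ _ (ltnW lt_k) Inv_st.
have [t1 [st1 [x1 [ex1 le_t1 [er1 Inv1]]]]] := step _ _ _ lt_k Inv_st.
rewrite -subSn // subSS in Inv1.
have [t2 [st2 [x2 [ex2 le_t2 Q2]]]] := IH _ _ (ltnW le_m) Inv1.
have [t3 [st3 [x3 [ex3 le_t3 [e3 e3']]]]] : wp (SetV r (IOp OpAdd (IV r) (IC 1))) st1 x1 6
    (fun st x => st = setv st1 r (nb - m) /\ x = x1).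
  apply: (@wp_setv _ _ _ _ 4) => //=; last by rewrite er1; split => //; congr setv; lia.
  by split=> //=; lia.
exists (ecost (compile (IOp OpLt (IV r) bound)) + (t1 + t3) + t2).+1, st2, x2.
split=> //; last by rewrite /=; lia.
apply: (@ExecWhileStep _ _ _ _ _ 0); last exact: ex2.
  by rewrite (eval_guard _ _ _ (ltnW lt_k) Inv_st) lt_k.
by rewrite -e3 -e3'; apply: ExecSeq ex1 ex3.
Qed.

End Programs.

(** * Sampling positions around the diagonal *)

Section Grid.
Variables n q : nat.
Hypothesis q_gt0 : 0 < q.

Fixpoint offset t :=
  if t is t'.+1 then minn n (offset t' + 1 + offset t' %/ q) else 0.

Lemma offset_le t : offset t <= n.
Proof. by case: t => //= t; apply: geq_minl. Qed.

(* q steps multiply offset + 1 by at least 2, as (1 + 1/q)^q >= 2. *)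
Lemma offset_exp m : offset (q * m) = n \/ 2 ^ m <= (offset (q * m)).+1.
Proof.
elim: m => [|m IH]; first by right.
have mulq t : offset t < q + q * (offset t %/ q).
  by rewrite {1}(divn_eq (offset t) q) addnC mulnC ltn_add2r ltn_mod.
(* Within q steps the lower bound on offset + 1 grows linearly from 2^m to 2 * 2^m: each step adds 1
   + offset %/ q, which is at least (offset + 1) / q, hence at least 2^m / q. *)
suff step r : offset (q * m + r) = n \/
    (q + r) * 2 ^ m <= q * (offset (q * m + r)).+1.
  rewrite mulnS addnC; case: (step q) => [->|le_q]; [by left | right].
  by rewrite -(leq_pmul2l q_gt0) expnS mulnA muln2 -addnn.
elim: r => [|r IHr]; first by rewrite !addn0 leq_pmul2l.
rewrite addnS /=; have le_n := offset_le (q * m + r).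
case: IHr => [->|IHr]; first by left; rewrite -addnA; apply/minn_idPl/leq_addr.
case: (leqP n (offset (q * m + r) + 1 + offset (q * m + r) %/ q)) => [?|_].
  by left.
right.
have := mulq (q * m + r).
have: 2 ^ m <= (offset (q * m + r)).+1.
  by rewrite -(leq_pmul2l q_gt0); move: IHr; rewrite mulnDl; lia.
move: IHr; rewrite !mulnDl ?mulSn !mulnS ?mulnDr; move: (_ * (_ %/ _)); lia.
Qed.

Lemma offset_reach m : n < 2 ^ m -> offset (q * m) = n.
Proof.
by move=> lt_n; have := offset_le (q * m); case: (offset_exp m) => //; lia.
Qed.

(** Take the first offset reaching d. Its predecessor s is below d and the gap is at most 1 + s %/
    q, so the overshoot is at most s %/ q <= d / q. *)
Lemma offset_up d t : d <= offset t ->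
  exists t', [/\ t' <= t, d <= offset t' & q * (offset t' - d) <= d].
Proof.
elim: t => [|t IH] le_d.
  by exists 0; move: le_d; rewrite /= leqn0 => /eqP->; rewrite muln0.
case: (leqP d (offset t)) => [/IH[t' [le_t' ? ?]]|lt_d].
  by exists t'; split=> //; apply: leqW.
exists t.+1; split=> //.
have := leq_divM (offset t) q => le_q.
have: offset t.+1 - d <= offset t %/ q.
  by rewrite /=; move: (_ %/ _) => ?; lia.
rewrite -(leq_pmul2l q_gt0) => /leq_trans; apply.
by rewrite mulnC (leq_trans le_q) // ltnW.
Qed.

(** Dually, take the last offset s that does not exceed d: the next one is at most s + 1 + s %/
    q. *)
Lemma offset_down d t : d <= offset t ->
  exists t', [/\ t' <= t, offset t' <= d & q * (d - offset t') <= d].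
Proof.
elim: t => [|t IH] le_d.
  by exists 0; move: le_d; rewrite /= leqn0 => /eqP->; rewrite muln0.
case: (leqP d (offset t)) => [/IH[t' [le_t' ? ?]]|lt_d].
  by exists t'; split=> //; apply: leqW.
have := leq_divM (offset t) q => le_q.
case: (eqVneq d (offset t.+1)) => [->|ne_d].
  by exists t.+1; split=> //; rewrite subnn muln0.
exists t; split=> //; first exact: ltnW.
have: d - offset t <= offset t %/ q 
  by move: le_d ne_d; rewrite /=; move: (_ %/ _) => ?; lia.
rewrite -(leq_pmul2l q_gt0) => /leq_trans; apply.
by rewrite mulnC (leq_trans le_q) // ltnW.
Qed.

Definition gridpos i u :=
  if odd u then i - offset u./2 else minn n (i + offset u./2).

Lemma gridpos_le i u : i <= n -> gridpos i u <= n.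
Proof. by rewrite /gridpos; case: odd; lia. Qed.

(** Positions are always rounded up. Left of the diagonal this means rounding the distance i - j
    down, right of it rounding j - i up. *)
Lemma gridpos_cover i j m : i <= n -> j <= n -> n < 2 ^ m ->
  exists u, [/\ u < 2 * (q * m + 1), j <= gridpos i u
    & q * (gridpos i u - j) <= (i - j) + (j - i)].
Proof.
move=> le_i le_j /offset_reach reach; case: (leqP j i) => [le_ji|lt_ij].
  have le_d : i - j <= offset (q * m) by rewrite reach; lia.
  have [t [le_t le_o le_q]] := offset_down le_d; exists t.*2.+1.
  rewrite /gridpos /= odd_double uphalf_double /=; split; [lia|lia|].
  by rewrite subnAC (leq_trans le_q) ?leq_addr.
have le_d : j - i <= offset (q * m) by rewrite reach; lia.
have [t [le_t le_o le_q]] := offset_up le_d; exists t.*2.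
rewrite /gridpos odd_double half_double /=; split; [lia|lia|].
have: minn n (i + offset t) - j <= offset t - (j - i) by lia.
by rewrite -(leq_pmul2l q_gt0); lia.
Qed.

End Grid.

(** * Error propagation *)

Section Alignment.
Variables (Sigma : eqType) (x y : seq Sigma).

Definition prefixLCS i j := LCS (take i x) (take j y).
Local Notation L := prefixLCS.

Lemma prefixLCS_lel i j : L i j <= i.
Proof. by rewrite (leq_trans (LCS_sizel _ _)) // size_take_min geq_minl. Qed.

Lemma prefixLCS_ler i j : L i j <= j.
Proof. by rewrite (leq_trans (LCS_sizer _ _)) // size_take_min geq_minl. Qed.

Lemma leq_prefixLCS i i' j j' : i <= i' -> j <= j' -> L i j <= L i' j'.
Proof.
move=> le_i le_j; apply: leq_LCS.
  by rewrite -(take_takel x le_i) take_subseq.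
by rewrite -(take_takel y le_j) take_subseq.
Qed.

Lemma takeS T (s : seq T) i : i < size s ->
  exists2 a, onth s i = Some a & take i.+1 s = rcons (take i s) a.
Proof.
case: s => // a0 s lt_i; exists (nth a0 (a0 :: s) i); first exact: onth_lt.
exact: take_nth.
Qed.

Lemma prefixLCS_match i j : i < size x -> j < size y ->
  L i j + (onth x i == onth y j) <= L i.+1 j.+1.
Proof.
case: eqP => [exy|_] lt_i lt_j; last by rewrite addn0 leq_prefixLCS.
have [a xa ex] := takeS lt_i; have [b yb ey] := takeS lt_j.
move: exy; rewrite xa yb => -[eab]; rewrite addn1 /L ex ey eab.
exact: LCS_rcons_match.
Qed.

Lemma prefixLCS_rec i j : i < size x -> j < size y ->
  L i.+1 j.+1 <= maxn (maxn (L i j.+1) (L i.+1 j)) (L i j + (onth x i == onth y j)).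
Proof.
move=> lt_i lt_j; have [a xa ex] := takeS lt_i; have [b yb ey] := takeS lt_j.
rewrite /L ex ey xa yb (inj_eq Some_inj) [maxn (LCS _ (rcons _ _)) _]maxnC.
exact: LCS_rcons_le.
Qed.

Lemma prefixLCS_lip i j j' : j' <= size y -> L i j' <= L i j + (j' - j).
Proof.
elim: j' => [|j' IH] le_j'; first by rewrite (leq_trans (prefixLCS_ler _ _)).
case: (ltnP j' j) => [lt_j|le_j].
  by rewrite (leq_trans (leq_prefixLCS (leqnn i) lt_j)) ?leq_addr.
have [b yb ey] := takeS le_j'.
rewrite subSn // addnS; apply: (@leq_trans (L i j').+1).
  by rewrite /L ey LCS_rconsr.
by rewrite ltnS IH // ltnW.
Qed.

(** The LCS recurrence on the block following position i, with row 0 replaced by U. The nested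
    fixpoint follows the lexicographic order of the cells, so that [alignSS] holds by
    computation. *)
Fixpoint align (U : nat -> nat) i p : nat -> nat :=
  if p is p'.+1 then
    fix row j :=
      if j is j'.+1 then
        maxn (maxn (align U i p' j) (row j'))
             (align U i p' j' + (onth x (i + p') == onth y j'))
      else align U i p' 0
  else U.

Lemma alignSS U i p j : align U i p.+1 j.+1 =
  maxn (maxn (align U i p j.+1) (align U i p.+1 j))
       (align U i p j + (onth x (i + p) == onth y j)).
Proof. by []. Qed.

Lemma align_sound U i p j : (forall j, j <= size y -> U j <= L i j) ->
  i + p <= size x -> j <= size y -> align U i p j <= L (i + p) j.
Proof.
move=> sU; elim: p j => [|p IHp] j; first by rewrite addn0 => _; apply: sU.
rewrite addnS => lt_p; elim: j => [|j IHj] lt_j.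
  by rewrite (leq_trans (IHp 0 (ltnW lt_p) lt_j)) // leq_prefixLCS.
have := prefixLCS_match lt_p lt_j; have := IHj (ltnW lt_j).
have := IHp _ (ltnW lt_p) lt_j; have := IHp _ (ltnW lt_p) (ltnW lt_j).
have := leq_prefixLCS (leqnSn (i + p)) (leqnn j.+1).
have := leq_prefixLCS (leqnn (i + p).+1) (leqnSn j).
rewrite alignSS !geq_max; lia.
Qed.

(** From row 1 on, each cell is a maximum that includes its left neighbour; row 0 is the arbitrary
    U. *)
Lemma leq_align U i p j j' : 0 < p -> j <= j' -> align U i p j <= align U i p j'.
Proof.
case: p => // p _ /subnK <-; elim: (j' - j) => // d IH.
by rewrite (leq_trans IH) // addSn alignSS !leq_max leqnn orbT.
Qed.

(* i + j - 2 L is the indel distance of the two prefixes: U undervalues L by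
   at most k / q times this distance. *)
Definition precise q k i (U : nat -> nat) :=
  forall j, j <= size y -> (q + 2 * k) * L i j <= q * U j + k * (i + j).

(** The value of L in a cell comes from one of three neighbours, and [align] takes at least the
    corresponding candidate, so the inequality is inherited from that neighbour. *)
Lemma align_precise U q k i p : precise q k i U -> i + p <= size x ->
  precise q k (i + p) (align U i p).
Proof.
move=> pU; elim: p => [|p IHp]; first by rewrite addn0.
rewrite addnS => lt_p; elim=> [|j IHj] lt_j.
  by have := prefixLCS_ler (i + p).+1 0; rewrite leqn0 => /eqP->; rewrite muln0.
have := prefixLCS_rec lt_p lt_j; have := IHj (ltnW lt_j).
have := IHp (ltnW lt_p) _ lt_j; have := IHp (ltnW lt_p) _ (ltnW lt_j).
rewrite alignSS.
set a := (_ == _ :> option _).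
move: (align _ _ p.+1 j) (align _ _ p j.+1) (align _ _ p j).
move: (L _ _) (L _ _) (L _ _) (L _ _) => l1 l2 l3 l4 u1 u2 u3 h1 h2 h3.
rewrite !leq_max -orbA => /or3P[] le_l;
  apply: (leq_trans (leq_mul (leqnn (q + 2 * k)) le_l)).
- apply: (leq_trans h2); apply: leq_add; last by rewrite leq_mul2l; lia.
  by rewrite leq_mul2l !leq_max leqnn orbT.
- apply: (leq_trans h3); apply: leq_add; last by rewrite leq_mul2l; lia.
  by rewrite leq_mul2l !leq_max leqnn !orbT.
(* On a match both sides grow by q + 2k; otherwise only the right one grows. *)
apply: (@leq_trans (q * (u3 + a) + k * ((i + p).+1 + j.+1))).
  by move: h1; case: (a); rewrite ?addn0 ?addn1 !mulnDl !mulnDr ?mulnS ; lia.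
by rewrite leq_add2r leq_mul2l leq_max leqnn !orbT.
Qed.

Definition interpolate m (G A : nat -> nat) j := \max_(u < m) (A u - (G u - j)).

(** Going down from G u to j decreases L by at most G u - j; if j is above G u, the truncated
    difference is 0 and monotonicity suffices. *)
Lemma interpolate_sound i m G A j :
  (forall u, u < m -> G u <= size y /\ A u <= L i (G u)) -> j <= size y ->
  interpolate m G A j <= L i j.
Proof.
move=> GA le_j; apply/bigmax_leqP => u _.
have [le_G le_A] := GA u (ltn_ord u).
by have := prefixLCS_lip i j le_G; lia.
Qed.

(** Passing from k to k + 1 enlarges the allowed error by i + j - 2 L. As L is at most i and j, this
    is at least the distance from i to j, which pays for q times the rounding G u - j. *)
Lemma interpolate_precise q k i m G A V : precise q k i V ->
  {homo V : j j' / j <= j'} ->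
  (forall u, u < m -> G u <= size y -> A u = V (G u)) ->
  (forall u, u < m -> G u <= size y) ->
  (forall j, j <= size y -> exists u,
     [/\ u < m, j <= G u & q * (G u - j) <= (i - j) + (j - i)]) ->
  precise q k.+1 i (interpolate m G A).
Proof.
move=> pV homoV AV Gy cover j le_j; have [u [lt_u le_jG le_q]] := cover j le_j.
have le_I : A u - (G u - j) <= interpolate m G A j.
  exact: (@leq_bigmax _ (fun u : 'I_m => A u - (G u - j)) (Ordinal lt_u)).
have := pV j le_j; have := prefixLCS_lel i j; have := prefixLCS_ler i j.
have: q * V j <= q * interpolate m G A j + q * (G u - j).
  rewrite -mulnDr leq_mul2l; apply/orP; right.
  rewrite AV ?Gy // in le_I; have := homoV _ _ le_jG; lia.
have -> : (q + 2 * k.+1) * L i j = (q + 2 * k) * L i j + 2 * L i j.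
  by rewrite mulnS [2 + _]addnC addnA mulnDl.
rewrite (mulSn k); move: (q * _) (q * _) (q * _) (k * _) ((q + _) * _) le_q.
lia.
Qed.

End Alignment.

(** * The program *)

Declare Scope iexp_scope.
Delimit Scope iexp_scope with I.
Bind Scope iexp_scope with iexp.
Local Infix "+" := (IOp OpAdd) : iexp_scope.
Local Infix "-" := (IOp OpSub) : iexp_scope.
Local Infix "*" := (IOp OpMul) : iexp_scope.
Local Infix "%/" := (IOp OpDiv) : iexp_scope.
Local Infix "<" := (IOp OpLt) : iexp_scope.
Local Infix "==" := (IOp OpEq) : iexp_scope.
Local Notation "c1 ;; c2" := (Seq c1 c2) (at level 90, right associativity).
Local Notation "r ::= e" := (SetV r e%I) (at level 80).
Arguments SetA r ei%_I e%_I.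
Arguments Read ei%_I.
Arguments For r bound%_I c.

(* Subtraction is truncated. *)
Definition imax e1 e2 := (e1 + (e2 - e1))%I.
Definition imin e1 e2 := (e1 - (e1 - e2))%I.

(** Roles of the cells: [pos] counts the symbols of x read so far, [ell] is the bit length of n,
    [prc] is q and [gsz] the number of stored positions; [top] is the entry of U for the current
    column. Unprimed arrays hold the samples of the previous update, primed ones those being built.
    Array r here is array r + 1 of the memory, array 0 being the block of x. *)
Local Notation out := 0.
Local Notation pos := 1.
Local Notation ell := 2.
Local Notation pow := 3.
Local Notation bsz := 4.
Local Notation prc := 5.
Local Notation gsz := 6.
Local Notation len := 7.
Local Notation cnt := 8.
Local Notation col := 9.
Local Notation top := 10.
Local Notation diag := 11.
Local Notation off := 12.
Local Notation tmp := 13.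
Local Notation column := 0.
Local Notation grid := 1.
Local Notation vals := 2.
Local Notation grid' := 3.
Local Notation vals' := 4.

(** Q / P is a rational substitute for delta. Since no work is done outside updates, the parameters
    are recomputed in each one, in time linear in n. Comparisons serve as 0/1 factors in place of
    branches. *)
Definition set_params P Q : cmd :=
  ell ::= IC 0 ;; pow ::= IC 1 ;;
  For cnt IL
   (ell ::= IV ell + (IV pow < IL + IC 1) ;;
    pow ::= IV pow + IV pow * (IV pow < IL + IC 1)) ;;
  bsz ::= IC 0 ;;
  For cnt IL
   (bsz ::= IV bsz + (IV bsz * IV bsz * IC Q < IL * IC P * IV ell)) ;;
  prc ::= (IC 2 * (IL %/ IV bsz + IC 1) * IC P) %/ IC Q + IC 1 ;;
  gsz ::= IC 2 * (IV prc * IV ell + IC 1) ;;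
  len ::= imin (IV bsz) (IL - IV pos).

Definition read_block : cmd :=
  SetA column (IC 0) (IC 0) ;;
  For cnt (IV len)
   (Read (IV cnt) ;; SetA column (IV cnt + IC 1) (IC 0)) ;;
  pos ::= IV pos + IV len.

Definition set_grid : cmd :=
  off ::= IC 0 ;;
  For cnt (IV prc * IV ell + IC 1)%I
   (SetA grid' (IC 2 * IV cnt) (imin IL (IV pos + IV off)) ;;
    SetA grid' (IC 2 * IV cnt + IC 1) (IV pos - IV off) ;;
    SetA vals' (IC 2 * IV cnt) (IC 0) ;;
    SetA vals' (IC 2 * IV cnt + IC 1) (IC 0) ;;
    off ::= imin IL (IV off + IC 1 + IV off %/ IV prc)).

(** The row U has n + 1 entries and is never stored: each entry is recomputed from the samples when
    its column is reached, which keeps the space small. *)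
Definition set_top : cmd :=
  top ::= IC 0 ;;
  For cnt (IV gsz)
   (top ::= imax (IV top)
                 (IA vals (IV cnt) - (IA grid (IV cnt) - IV col))).

(** The recurrence runs column by column, in place; [diag] saves the old entry that was just
    overwritten. In column 0 the factor 0 < col cancels the match, and the truncated col - 1 keeps
    the query inside y. *)
Definition next_column : cmd :=
  diag ::= IA column (IC 0) ;;
  SetA column (IC 0) (IV top) ;;
  For cnt (IV len)
   (tmp ::= IA column (IV cnt + IC 1) ;;
    SetA column (IV cnt + IC 1) 
      (imax (imax (IV tmp) (IA column (IV cnt)))
            (IV diag + (IC 0 < IV col) * IMatch (IV cnt) (IV col - IC 1))) ;;
    diag ::= IV tmp).

(** As [vals'] starts at 0 and each column is visited once, adding the value times the indicator
    acts as an assignment. *)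
Definition sample_column : cmd :=
  For cnt (IV gsz)
   (SetA vals' (IV cnt)
      (IA vals' (IV cnt) +
       (IA grid' (IV cnt) == IV col) * IA column (IV len))).

Definition end_update : cmd :=
  out ::= IL - IA column (IV len) ;;
  For cnt (IV gsz)
   (SetA grid (IV cnt) (IA grid' (IV cnt)) ;;
    SetA vals (IV cnt) (IA vals' (IV cnt))).

Definition update P Q : cmd :=
  set_params P Q ;; read_block ;; set_grid ;;
  For col (IL + IC 1)%I (set_top ;; next_column ;; sample_column) ;;
  end_update.

(** * Integer parameters of the program *)

Fixpoint bits n k := if k is k'.+1 then bits n k' + (2 ^ bits n k' < n + 1) else 0.
(** The number of binary digits of n; n rounds suffice because n < 2^n. *)
Definition nbits n := bits n n.

(* For k large enough, the least b such that b ^ 2 * Q >= n * P * nbits n. *)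
Fixpoint isqrt P Q n k :=
  if k is k'.+1 then
    let b := isqrt P Q n k' in b + (b * b * Q < n * P * nbits n)
  else 0.
Definition bsize P Q n := isqrt P Q n n.
(** The last + 1 turns the floor into an upper bound of the quotient and keeps q positive. *)
Definition precision P Q n := 2 * (n %/ bsize P Q n + 1) * P %/ Q + 1.
Definition gsize P Q n := 2 * (precision P Q n * nbits n + 1).

Lemma bits_le n k : bits n k <= k.
Proof. by elim: k => //= k IH; move: (_ < _) => []; lia. Qed.

Lemma isqrt_le P Q n k : isqrt P Q n k <= k.
Proof. by elim: k => //= k IH; move: (_ < _) => []; lia. Qed.

Lemma pow_bits n k : 2 ^ bits n k <= n.*2.+1.
Proof.
elim: k => //= k IH; case: ltnP => lt_n; last by rewrite addn0.
by rewrite addn1 expnS; lia.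
Qed.

Lemma ltn_bits n : n < 2 ^ nbits n.
Proof.
suff main k : bits n k = k \/ n < 2 ^ bits n k.
  by case: (main n) => //; rewrite /nbits => ->; apply: ltn_expl.
elim: k => /= [|k IH]; first by left.
case: (ltnP (2 ^ bits n k)) => lt_n; last by right; rewrite addn0; lia.
by case: IH => [->|]; [left; rewrite addn1 | lia].
Qed.

Lemma nbits_gt0 n : 0 < n -> 0 < nbits n.
Proof. by case: n => // n _; have := ltn_bits n.+1; case: nbits. Qed.

Lemma bsize_gt0 P Q n : 0 < P -> 0 < n -> 0 < bsize P Q n.
Proof.
move=> P_gt0 n_gt0; have b_gt0 := nbits_gt0 n_gt0; rewrite /bsize.
case: {1 3}n n_gt0 => // k _ /=; case: (posnP (isqrt P Q n k)) => [->|]; last by lia.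
by rewrite mul0n !muln_gt0 P_gt0 b_gt0 andbT; case: (n) b_gt0.
Qed.

(** * Correctness, time and number of updates *)

Section Update.
Variables (Sigma : eqType) (n : nat) (x y : seq Sigma) (P Q W M : nat).
Hypotheses (size_x : size x = n) (size_y : size y = n).
Let b := bsize P Q n.
Let q := precision P Q n.
Let N := gsize P Q n.
Hypotheses (leM : b + N < M) (leMW : nscal + narr * M <= W).
(** Room for the intermediate results: b * b, b * b * Q, n * P * l and the numerator in the
    definition of q. *)
Hypotheses (leW : n * 10 + 10 <= W) (leNW : n * n <= W) (leQW : n * n * Q <= W)
  (lePW : n * P * n <= W) (lePQW : 2 * (n + 1) * P + P + Q < W).

Let lt_yW : size y < W. Proof. lia. Qed.

Local Notation wp := (@wp Sigma y W M).

Ltac solve_ok :=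
  rewrite /= ?size_y; repeat split; rewrite ?size_y; try lia.

Ltac wstep :=
  try eapply wp_seq;
  first
  [ eapply (wp_setv leMW lt_yW); [exact: isT | solve_ok | exact: leqnn | ]
  | eapply (wp_seta leMW lt_yW); 
      [exact: isT | solve_ok | solve_ok | solve_ok | exact: leqnn | ]
  | eapply (wp_read leMW lt_yW); [solve_ok | solve_ok | exact: leqnn | ] ];
  rewrite /setv /seta /setb /= ?size_y.

(** The running time is left as an existential variable, filled in by symbolic execution and
    compared with the announced bound last. *)
Ltac wstart := eapply wp_weaken; [ | let h := fresh in intros ? ? h; exact h | ].

Lemma wp_set_params o i l pw b0 q0 N0 len0 k j U d s t ars X z K :
  (forall pw k,
     K (St [:: o; i; nbits n; pw; b; q; N; minn b (n - i); k; j; U; d; s; t]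
           ars X) z) ->
  wp (set_params P Q)
     (St [:: o; i; l; pw; b0; q0; N0; len0; k; j; U; d; s; t] ars X) z
     (1000 * (n + 1)) K.
Proof.
move=> HK; wstart; last first.
  wstep; wstep.
  eapply wp_seq.
  eapply (wp_for leMW lt_yW (nb := n) (Tb := 50) (Te := 1)
    (Inv := fun k st z' => z' = z /\
       st = St [:: o; i; bits n k; 2 ^ bits n k; b0; q0; N0; len0; k;
                   j; U; d; s; t] ars X)) => //=.
  - lia.
  - by move=> k1 st1 x1 _ [_ ->].
  - move=> k1 st1 x1 lt_k [-> ->].
    have := bits_le n k1; have := pow_bits n k1 => le_p le_b.
    wstart; last first.
    + wstep.
      wstep.
      split=> //; split=> //.
      congr (St [:: _; _; _; _; _; _; _; _; _; _; _; _; _; _] _ _).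
      by case: (2 ^ _ < n + 1); rewrite ?muln0 ?muln1 ?addn0 // addn1 expnS mul2n addnn.
    by [].
  move=> st2 z2 [-> ->].
  wstep.
  eapply wp_seq.
  eapply (wp_for leMW lt_yW (nb := n) (Tb := 50) (Te := 1)
    (Inv := fun k st z' => z' = z /\
       st = St [:: o; i; nbits n; 2 ^ nbits n; isqrt P Q n k; q0; N0; len0; k;
                   j; U; d; s; t] ars X)) => //=.
  - lia.
  - by move=> k1 st1 x1 _ [_ ->].
  - move=> k1 st1 x1 lt_k [-> ->].
    have := isqrt_le P Q n k1; have := bits_le n n => le_p le_b.
    have leQ : isqrt P Q n k1 * isqrt P Q n k1 * Q <= W.
      by apply: leq_trans leQW; rewrite leq_mul2r leq_mul ?orbT //; lia.
    have leb2 : isqrt P Q n k1 * isqrt P Q n k1 <= W.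
      by apply: leq_trans leNW; rewrite leq_mul //; lia.
    have leP : n * P * nbits n <= W.
      by apply: leq_trans lePW; apply: leq_mul.
    wstart; last first.
    + by wstep; last by split.
    by [].
  move=> st3 z3 [-> ->]; rewrite -/(bsize P Q n) -/b.
  have le_d := leq_div (2 * (n %/ b + 1) * P) Q.
  have le_m : 2 * (n %/ b + 1) * P <= 2 * (n + 1) * P.
    by rewrite leq_mul2r leq_mul2l leq_add2r leq_div !orbT.
  have le_db := leq_div n b.
  have le_bn : b <= n by exact: isqrt_le.
  have eq_q : 2 * (n %/ b + 1) * P %/ Q + 1 = q by [].
  wstep.
  rewrite eq_q.
  have leGW : 2 * (q * nbits n + 1) <= W.
    by move: leM leMW; rewrite /nscal /narr -/N /N /gsize -/q; lia.
  wstep; wstep.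
  have -> : b - (b - (n - i)) = minn b (n - i) by lia.
  exact: HK.
rewrite /=; lia.
Qed.

Lemma wp_read_block o i l pw b0 q0 N0 ln k j U d s t v G A G' A' X z K :
  ln <= n - i -> ln < M -> i <= n -> z = drop i x ->
  (forall k v' X',
    (forall p, p <= ln -> v' p = 0) ->
    (forall p, p < ln -> exists2 a, onth x (i + p) = Some a & X' p = Sym a) ->
    K (St [:: o; i + ln; l; pw; b0; q0; N0; ln; k; j; U; d; s; t]
          [:: v'; G; A; G'; A'] X') (drop (i + ln) x)) ->
  wp read_block (St [:: o; i; l; pw; b0; q0; N0; ln; k; j; U; d; s; t]
    [:: v; G; A; G'; A'] X) z (100 * (n + 1)) K.
Proof.
move=> le_ln lt_lnM le_i ez HK; wstart; last first.
  wstep.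
  eapply wp_seq.
  eapply (wp_for leMW lt_yW (nb := ln) (Tb := 50) (Te := 2)
    (Inv := fun k st z' => z' = drop (i + k) x /\
      exists v' X', [/\ st = St [:: o; i; l; pw; b0; q0; N0; ln; k; j; U; d; s; t]
                              [:: v'; G; A; G'; A'] X',
        forall p, p <= k -> v' p = 0 &
        forall p, p < k -> exists2 a, onth x (i + p) = Some a & X' p = Sym a])) => //=.
  - lia.
  - rewrite addn0; split=> //; exists (fupd v 0 0), X; split=> // p.
    by rewrite leqn0 => /eqP->.
  - by move=> k1 st1 x1 _ [_ [v1 [X1 [-> _ _]]]].
  - move=> k1 st1 x1 lt_k [-> [v1 [X1 [-> v0 Xx]]]].
    have lt_ik : i + k1 < size x by lia.
    have [a xa _] := takeS lt_ik.
    have -> : drop (i + k1) x = a :: drop (i + k1.+1) x.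
      by rewrite (drop_nth a lt_ik) addnS; congr cons; apply: onth_nth xa.
    wstart; last first.
    + wstep; wstep; split=> //; split=> //; do 2!eexists; split; first reflexivity.
        by move=> p le_p; rewrite /fupd addn1; case: eqP => // ne; apply: v0; lia.
      move=> p lt_p; rewrite /fupd; case: eqP => [->|ne]; first by exists a.
      by apply: Xx; lia.
    by [].
  move=> st2 z2 [-> [v1 [X1 [-> v0 Xx]]]].
  wstep.
  exact: HK.
rewrite /=; nia.
Qed.

Lemma wp_set_grid o i l pw b0 ln k j U d s t v G A G' A' X z K :
  i <= n -> l = nbits n ->
  (forall k s G' A',
    (forall u, u < N -> G' u = gridpos n q i u) ->
    (forall u, u < N -> A' u = 0) ->
    K (St [:: o; i; l; pw; b0; q; N; ln; k; j; U; d; s; t] [:: v; G; A; G'; A'] X) z) ->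
  wp set_grid (St [:: o; i; l; pw; b0; q; N; ln; k; j; U; d; s; t]
    [:: v; G; A; G'; A'] X) z (200 * (N + 1)) K.
Proof.
move=> le_i -> HK.
have eN : N = 2 * (q * nbits n + 1) by [].
have leNW' : N < W by move: leM leMW; rewrite /nscal /narr; lia.
wstart; last first.
  wstep.
  eapply (wp_for leMW lt_yW (nb := q * nbits n + 1) (Tb := 150) (Te := 10)
    (Inv := fun k st z' => z' = z /\
      exists G1 A1, [/\ st = St [:: o; i; nbits n; pw; b0; q; N; ln; k; j; U; d;
                                   offset n q k; t]
                              [:: v; G; A; G1; A1] X,
        forall u, u < 2 * k -> G1 u = gridpos n q i u &
        forall u, u < 2 * k -> A1 u = 0])) => //=.
  - lia.
  - by split=> //; exists G', A'; split=> // u; rewrite muln0.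
  - move=> k1 st1 x1 le_k [_ [G1 [A1 [-> _ _]]]]; rewrite /=; repeat split; lia.
  - move=> k1 st1 x1 lt_k [-> [G1 [A1 [-> G1E A1E]]]].
    have le_o := offset_le n q k1; have le_oq := leq_div (offset n q k1) q.
    have le_0q := leq_addr (offset n q k1 %/ q) (offset n q k1).
    wstart; last first.
    + wstep; wstep; wstep; wstep; wstep; split=> //; split=> //; do 2!eexists; split.
      * congr (St [:: _; _; _; _; _; _; _; _; _; _; _; _; _; _] _ _).
        by rewrite minnE.
      * move=> u lt_u; rewrite /fupd /gridpos.
        case: eqP => [->|ne1]; first by
          rewrite addn1 /= mul2n odd_double /= uphalf_double.
        case: eqP => [->|ne2]; first by rewrite mul2n odd_double half_double minnE.
        by rewrite G1E //; lia.
      move=> u lt_u; rewrite /fupd.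
      by case: eqP => // ne1; case: eqP => // ne2; rewrite A1E //; lia.
    by [].
  move=> st2 z2 [-> [G1 [A1 [-> G1E A1E]]]].
  by apply: HK => u lt_u; [apply: G1E|apply: A1E]; lia.
rewrite /=; lia.
Qed.

Lemma wp_set_top o i l pw b0 ln k j U d s t v G A G' A' X z K :
  j <= n -> (forall u, u < N -> G u <= n /\ A u <= n) ->
  (forall k, K (St [:: o; i; l; pw; b0; q; N; ln; k; j; interpolate N G A j; d; s; t]
              [:: v; G; A; G'; A'] X) z) ->
  wp set_top (St [:: o; i; l; pw; b0; q; N; ln; k; j; U; d; s; t]
    [:: v; G; A; G'; A'] X) z (100 * (N + 1)) K.
Proof.
move=> le_j GAn HK; wstart; last first.
  wstep.
  eapply (wp_for leMW lt_yW (nb := N) (Tb := 50) (Te := 10)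
    (Inv := fun k st z' => z' = z /\
      st = St [:: o; i; l; pw; b0; q; N; ln; k; j; interpolate k G A j; d; s; t]
              [:: v; G; A; G'; A'] X)) => //=.
  - by move: leM leMW; rewrite /nscal /narr; lia.
  - by rewrite /interpolate big_ord0.
  - by move=> k1 st1 x1 le_k [_ ->].
  - move=> k1 st1 x1 lt_k [-> ->].
    have [le_G le_A] := GAn k1 lt_k.
    have le_I : interpolate k1 G A j <= n.
      apply/bigmax_leqP => u _; have [_ le_u] := GAn u (ltn_trans (ltn_ord u) lt_k).
      exact: leq_trans (leq_subr _ _) le_u.
    wstart; last first.
    + wstep; split=> //; split=> //.
      by rewrite /interpolate big_ord_recr /= maxnE.
    by [].
  by move=> st2 z2 [-> ->]; apply: HK.
rewrite /=; lia.
Qed.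

(** A fictitious column of zeros precedes column 0, so that column 0 is produced by the same code:
    the maximum then copies U 0 downwards. *)
Definition prev_column Uf i0 j p := if j is j'.+1 then align x y Uf i0 p j' else 0.

Lemma wp_next_column i0 Uf o i l pw b0 ln k j d s t v ars X z K :
  j <= n -> ln <= n -> ln < M ->
  (forall p j, p <= ln -> j <= n -> align x y Uf i0 p j <= n) ->
  (forall p, p <= ln -> v p = prev_column Uf i0 j p) ->
  (forall p, p < ln -> exists2 a, onth x (i0 + p) = Some a & X p = Sym a) ->
  (forall k d t v', (forall p, p <= ln -> v' p = align x y Uf i0 p j) ->
     K (St [:: o; i; l; pw; b0; q; N; ln; k; j; Uf j; d; s; t] (v' :: ars) X) z) ->
  wp next_column (St [:: o; i; l; pw; b0; q; N; ln; k; j; Uf j; d; s; t]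
    (v :: ars) X) z (200 * (ln + 1)) K.
Proof.
move=> le_j le_ln lt_ln le_al vE Xx HK.
have le_prev p : p <= ln -> prev_column Uf i0 j p <= n.
  by case: (j) le_j => //= j' lt_j le_p; apply: le_al => //; apply: ltnW.
wstart; last first.
  wstep; wstep.
  eapply (wp_for leMW lt_yW (nb := ln) (Tb := 150) (Te := 10)
    (Inv := fun k st z' => z' = z /\
      exists v' t, [/\ st = St [:: o; i; l; pw; b0; q; N; ln; k; j; Uf j;
                                  prev_column Uf i0 j k; s; t]
              (v' :: ars) X,
        forall p, p <= k -> v' p = align x y Uf i0 p j &
        forall p, k < p -> p <= ln -> v' p = prev_column Uf i0 j p])) => //=.
  - lia.
  - split=> //; exists (fupd v 0 (Uf j)), t; split; first by rewrite vE.
      by move=> p; rewrite leqn0 => /eqP->.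
    by move=> p p_gt0 le_p; rewrite /fupd gtn_eqF // vE.
  - by move=> k1 st1 x1 le_k [_ [v1 [t1 [-> _ _]]]].
  - move=> k1 st1 x1 lt_k [-> [v1 [t1 [-> v1E v1E']]]].
    have [a xa Xa] := Xx k1 lt_k.
    have e1 : v1 k1 = align x y Uf i0 k1 j by apply: v1E.
    have e2 : v1 (k1 + 1) = prev_column Uf i0 j k1.+1 by rewrite addn1; apply: v1E'.
    have le1 := le_prev _ lt_k; have le2 := le_prev _ (ltnW lt_k).
    have le3 := le_al _ j (ltnW lt_k) le_j.
    wstart; last first.
    + wstep; rewrite e2.
      have leM1 : (0 < j) * (onth y (j - 1) == Some a) <= 1.
        by case: (0 < j); case: (_ == _).
      wstep; rewrite ?Xa ?e1 //; try lia.
      wstep; split=> //; split=> //; do 2!eexists; split; first reflexivity.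
        move=> p le_p; rewrite /fupd addn1; case: eqP => [->|ne]; last first.
          by apply: v1E; lia.
        rewrite -!maxnE; case: (j) => [|j'].
          by rewrite /= maxn0 max0n.
        rewrite alignSS subn1 mul1n [maxn (align _ _ _ _ _ j'.+1) _]maxnC.
        by rewrite xa [onth y j' == _]eq_sym.
      by move=> p lt_p le_p; rewrite /fupd gtn_eqF ?addn1 // v1E' // ltnW.
    by [].
  by move=> st2 z2 [-> [v1 [t1 [-> v1E _]]]]; apply: HK.
rewrite /=; lia.
Qed.

Lemma wp_sample_column V o i l pw b0 ln k j U d s t v G A G' A' X z K :
  V <= n -> ln < M -> v ln = V -> (forall u, u < N -> G' u <= n /\ A' u <= n) ->
  (forall u, u < N -> A' u <> 0 -> G' u < j) ->
  (forall k A1, (forall u, u < N -> A1 u = if G' u == j then V else A' u) ->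
     K (St [:: o; i; l; pw; b0; q; N; ln; k; j; U; d; s; t] [:: v; G; A; G'; A1] X) z) ->
  wp sample_column (St [:: o; i; l; pw; b0; q; N; ln; k; j; U; d; s; t]
    [:: v; G; A; G'; A'] X) z (100 * (N + 1)) K.
Proof.
move=> le_V lt_ln vE GAn A'0 HK; wstart; last first.
  eapply (wp_for leMW lt_yW (nb := N) (Tb := 50) (Te := 10)
    (Inv := fun k st z' => z' = z /\ exists A1,
      [/\ st = St [:: o; i; l; pw; b0; q; N; ln; k; j; U; d; s; t]
                 [:: v; G; A; G'; A1] X,
        forall u, u < k -> A1 u = (if G' u == j then V else A' u) &
        forall u, k <= u -> A1 u = A' u])) => //=.
  - by move: leM leMW; rewrite /nscal /narr; lia.
  - by split=> //; exists A'.
  - by move=> k1 st1 x1 le_k [_ [A1 [-> _ _]]].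
  - move=> k1 st1 x1 lt_k [-> [A1 [-> A1E A1E']]].
    have [le_G' le_A'] := GAn k1 lt_k; have e1 := A1E' _ (leqnn k1).
    have leV1 : (G' k1 == j) * V <= n by case: (_ == _); rewrite ?mul1n ?mul0n.
    wstart; last first.
    + wstep; rewrite ?vE ?e1; try lia.
      split=> //; split=> //; eexists; split; first reflexivity.
        move=> u lt_u; rewrite /fupd; case: eqP => [->|ne].
          case: eqP => [eG|_]; last by rewrite mul0n addn0.
          (* A slot whose position is the current column has not been filled yet, so it holds 0. *)
          rewrite mul1n; case: (eqVneq (A' k1) 0) => [-> //|/eqP/(A'0 _ lt_k)].
          by rewrite eG ltnn.
        by apply: A1E; lia.
      by move=> u lt_u; rewrite /fupd gtn_eqF // A1E' // ltnW.
    by [].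
  by move=> st2 z2 [-> [A1 [-> A1E _]]]; apply: HK.
rewrite /=; lia.
Qed.

Lemma wp_end_update V o i l pw b0 ln k j U d s t v G A G' A' X z K :
  V <= n -> ln < M -> v ln = V -> (forall u, u < N -> G' u <= n /\ A' u <= n) ->
  (forall k G1 A1, (forall u, u < N -> G1 u = G' u /\ A1 u = A' u) ->
     K (St [:: n - V; i; l; pw; b0; q; N; ln; k; j; U; d; s; t]
           [:: v; G1; A1; G'; A'] X) z) ->
  wp end_update (St [:: o; i; l; pw; b0; q; N; ln; k; j; U; d; s; t]
    [:: v; G; A; G'; A'] X) z (100 * (N + 1)) K.
Proof.
move=> le_V lt_ln vE GAn HK; wstart; last first.
  wstep; rewrite ?vE; try lia.
  eapply (wp_for leMW lt_yW (nb := N) (Tb := 50) (Te := 10)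
    (Inv := fun k st z' => z' = z /\ exists G1 A1,
      st = St [:: n - V; i; l; pw; b0; q; N; ln; k; j; U; d; s; t]
              [:: v; G1; A1; G'; A'] X /\
      forall u, u < k -> G1 u = G' u /\ A1 u = A' u)) => //=.
  - by move: leM leMW; rewrite /nscal /narr; lia.
  - by split=> //; exists G, A.
  - by move=> k1 st1 x1 le_k [_ [G1 [A1 [-> _]]]].
  - move=> k1 st1 x1 lt_k [-> [G1 [A1 [-> GAE]]]].
    have [le_G' le_A'] := GAn k1 lt_k.
    wstart; last first.
    + wstep; wstep; split=> //; split=> //; do 2!eexists; split; first reflexivity.
      move=> u lt_u; rewrite /fupd; case: eqP => [->//|ne].
      by apply: GAE; lia.
    by [].
  by move=> st2 z2 [-> [G1 [A1 [-> GAE]]]]; apply: HK.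
rewrite /=; lia.
Qed.

Local Notation L := (prefixLCS x y).

(** What survives between updates, after k of them and i symbols: the samples, the position and the
    output; all other cells are arbitrary. The output is constrained only once an update has taken
    place, n - o being then the value V(n). *)
Definition checkpoint k i (st : state Sigma) :=
  exists o l pw b0 q0 N0 ln c j U d s t v G A G' A' X,
  [/\ st = St [:: o; i; l; pw; b0; q0; N0; ln; c; j; U; d; s; t]
              [:: v; G; A; G'; A'] X,
      forall u, u < N -> G u <= n /\ A u <= L i (G u),
      precise x y q k i (interpolate N G A) &
      0 < k -> o <= n /\ n - o <= L i n /\
               (q + 2 * k) * L i n <= q * (n - o) + k * (i + n)].

Lemma wp_update k i st : 0 < b -> i < n -> checkpoint k i st ->
  wp (update P Q) st (drop i x) (2000 * (n + 1) * (N + b + 1))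
    (fun st' z => z = drop (i + minn b (n - i)) x /\
                  checkpoint k.+1 (i + minn b (n - i)) st').
Proof.
move=> b_gt0 lt_i.
move=> [o [l [pw [b0 [q0 [N0 [ln0 [c [j [U [d [s [t [v [G [A [G' [A' [X]]]]]]]]]]]]]]]]]]].
case=> -> GA prec_k _.
set ln := minn b (n - i); have ln_gt0 : 0 < ln by rewrite /ln; lia.
have le_bn : b <= n by exact: isqrt_le.
have le_iln : i + ln <= n by rewrite /ln; lia.
have lt_lnM : ln < M by rewrite /ln; lia.
have q_gt0 : 0 < q by rewrite /q /precision addn1.
set Uf := interpolate N G A in prec_k.
have Uf_sound j' : j' <= size y -> Uf j' <= L i j'.
  by apply: interpolate_sound => u /GA[]; rewrite size_y.
have al_sound p j' : p <= ln -> j' <= n -> align x y Uf i p j' <= L (i + p) j'.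
  by move=> le_p le_j'; apply: align_sound => //; rewrite ?size_x ?size_y //; lia.
have al_le p j' : p <= ln -> j' <= n -> align x y Uf i p j' <= n.
  move=> le_p le_j'; apply: leq_trans (al_sound _ _ le_p le_j') _.
  exact: leq_trans (prefixLCS_ler _ _ _ _) le_j'.
have GAn u : u < N -> G u <= n /\ A u <= n.
  move=> /GA[le_G le_A]; split=> //; apply: leq_trans le_A _.
  exact: leq_trans (prefixLCS_ler _ _ _ _) le_G.
have al_prec := align_precise prec_k (_ : i + ln <= size x).
rewrite size_x in al_prec; have {}al_prec := al_prec le_iln.
wstart; last first.
  eapply wp_seq; apply: wp_set_params => {pw c}pw c.
  eapply wp_seq; apply: wp_read_block => //; [by rewrite geq_minr | exact: ltnW | ].
  rewrite -/ln => {v X}{}c v X v0 Xx.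
  eapply wp_seq; apply: wp_set_grid => // {s G' A'}{}c s G' A' G'E A'0.
  have le_G' u : u < N -> G' u <= n by move=> /G'E->; apply: gridpos_le.
  eapply wp_seq.
  eapply (wp_for leMW lt_yW (nb := n + 1) (Te := 10)
    (Inv := fun j st z' => z' = drop (i + ln) x /\ exists c U d t v A',
      [/\ st = St [:: o; i + ln; nbits n; pw; b; q; N; ln; c; j; U; d; s; t]
                  [:: v; G; A; G'; A'] X,
          forall p, p <= ln -> v p = prev_column Uf i j p &
          forall u, u < N ->
            A' u = if G' u < j then align x y Uf i ln (G' u) else 0])) => //=.
  - lia.
  - by split=> //; exists c, U, d, t, v, A'; split.
  - move=> j1 st1 z1 le_j [_ [c1 [U1 [d1 [t1 [v1 [A1 [-> _ _]]]]]]]] /=.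
    by rewrite size_y; repeat split; lia.
  - move=> j1 st1 z1 lt_j [-> [c1 [U1 [d1 [t1 [v1 [A1 [-> v1E A1E]]]]]]]].
    have le_j : j1 <= n by lia.
    wstart; last first.
    + eapply wp_seq; apply: wp_set_top => // {}c1; rewrite -/Uf.
      have le_ln : ln <= n by rewrite /ln; lia.
      eapply wp_seq; apply: (@wp_next_column i Uf) => //.
      move=> {}c1 {}d1 {}t1 {v1E}v1 v1E.
      apply: (@wp_sample_column (align x y Uf i ln j1)) => //.
      * exact: al_le.
      * exact: v1E.
      * move=> u lt_u; split; first exact: le_G'.
        by rewrite A1E //; case: ifP => // _; apply: al_le => //; apply: le_G'.
      * by move=> u lt_u; rewrite A1E //; case: ifP.
      move=> {}c1 A2 A2E; split=> //; split=> //; exists c1, (Uf j1), d1, t1, v1, A2.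
      split=> // u lt_u; rewrite A2E // ltnS leq_eqVlt A1E //.
      by case: eqP => [->|_].
    exact: leqnn.
  move=> st2 z2 [-> [c1 [U1 [d1 [t1 [v1 [A1 [-> v1E A1E]]]]]]]].
  have {}A1E u : u < N -> A1 u = align x y Uf i ln (G' u).
    by move=> lt_u; rewrite A1E // addn1 ltnS le_G'.
  rewrite addn1 in v1E *.
  apply: (@wp_end_update (align x y Uf i ln n)) => //.
  + exact: al_le.
  + exact: v1E.
  + by move=> u lt_u; rewrite A1E // le_G' // al_le // le_G'.
  move=> {}c1 G2 A2 GA2; split=> //.
  exists (n - align x y Uf i ln n), (nbits n), pw, b, q, N, ln, c1, n.+1, U1, d1, s, t1.
  exists v1, G2, A2, G', A1, X.
  have GA2E u : u < N -> G2 u = gridpos n q (i + ln) u /\ A2 u = align x y Uf i ln (G2 u).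
    by move=> lt_u; have [-> ->] := GA2 _ lt_u; rewrite A1E // G'E.
  have le_G2 u : u < N -> G2 u <= n.
    by move=> lt_u; have [-> _] := GA2 _ lt_u; apply: le_G'.
  split=> //.
  + move=> u lt_u; split; first exact: le_G2.
    by have [_ ->] := GA2E _ lt_u; apply: al_sound => //; apply: le_G2.
  (* This is the only rounding of the update, and it raises k by one. *)
  + apply: interpolate_precise al_prec _ _ _ _ => //.
    * by move=> j1 j2; apply: leq_align.
    * by move=> u lt_u _; have [_ ->] := GA2E _ lt_u.
    * by rewrite size_y.
    rewrite size_y => j1 le_j.
    have lt_n : n < 2 ^ nbits n by apply: ltn_bits.
    have [u [lt_u le_g le_q]] := gridpos_cover q_gt0 le_iln le_j lt_n.
    by exists u; have [-> _] := GA2E u lt_u.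
  move=> _; have le_al := al_le ln n (leqnn _) (leqnn _); rewrite subKn //.
  split; first exact: leq_subr.
  split; first exact: al_sound.
  have le_ny : n <= size y by rewrite size_y.
  (* V(n) is read before rounding, hence satisfies the bound for k; the one for k + 1 follows since
     2 L is at most the sum of the two lengths. *)
  have := al_prec n le_ny; have := prefixLCS_lel x y (i + ln) n.
  have := prefixLCS_ler x y (i + ln) n.
  by rewrite mulnS mulSn; lia.
rewrite /= -/ln.
have le_lnb : ln <= b by apply: geq_minl.
move: (N) => N1; nia.
Qed.

(** Only the last block can be shorter than b, so k updates before it have read k * b symbols.
    Induction on the number of unread symbols. *)
Lemma run_update k st : 0 < b -> k * b < n -> checkpoint k (k * b) st ->
  exists ts st', [/\
    run y W (update P Q) (memory M st) (drop (k * b) x) ts (memory M st'),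
    {in ts, forall t, t <= 2000 * (n + 1) * (N + b + 1)},
    0 < size ts, k + size ts <= n %/ b + 1 & checkpoint (k + size ts) n st'].
Proof.
move=> b_gt0; have [m] := ubnP (n - k * b); elim: m k st => // m IH k st lt_m lt_k ck.
have [t [st1 [z1 [ex1 le_t [ez1 ck1]]]]] := wp_update b_gt0 lt_k ck.
have ne_x : drop (k * b) x <> [::].
  by move/(congr1 size); rewrite size_drop size_x /=; lia.
have le_k : k <= n %/ b by rewrite leq_divRL // ltnW.
have [lt_n|le_n] := ltnP (k.+1 * b) n; last first.
  have e : k * b + minn b (n - k * b) = n by rewrite mulSn in le_n; lia.
  rewrite e in ez1 ck1; exists [:: t], st1; rewrite [size _]/=; split=> //.
  - apply: RunUpdate ne_x ex1 _; rewrite ez1 drop_oversize ?size_x //.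
    exact: RunEnd.
  - by move=> t'; rewrite inE => /eqP->.
  - by rewrite leq_add2r.
  by rewrite addn1.
have e : k * b + minn b (n - k * b) = k.+1 * b by move: lt_n; rewrite mulSn; lia.
rewrite e in ez1 ck1.
have lt_m1 : n - k.+1 * b < m by move: lt_m lt_n; rewrite mulSn; lia.
have [ts [st2 [ex2 le_ts ts_gt0 le_kts ck2]]] := IH _ _ lt_m1 lt_n ck1.
exists (t :: ts), st2; rewrite [size _]/= -[k + _]addSnnS; split=> //.
  by apply: RunUpdate ne_x ex1 _; rewrite ez1.
by move=> t'; rewrite inE => /orP[/eqP->//|/le_ts].
Qed.

Lemma mem0 : nseq (nscal + narr * M) (Int 0) =
  memory M (St (nseq nscal 0) (nseq narr.-1 (fun=> 0)) (fun=> Int 0 : value Sigma)).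
Proof.
apply: (@eq_from_nth _ (Int 0)); first by rewrite size_nseq size_mkseq.
move=> a; rewrite size_nseq => lt_a; rewrite nth_nseq lt_a nth_mkseq //.
rewrite /contents /=; case: ltnP => [lt_a'|le_a].
  by rewrite (nth_nseq 0 nscal 0) lt_a'.
by case: (_ %% _) => // r; rewrite (nth_nseq (fun=> 0) narr.-1 (fun=> 0)); case: ifP.
Qed.

Lemma computes_update : 0 < b -> 0 < n -> 0 < Q ->
  exists ts v, [/\ computes y W (update P Q) (nscal + narr * M) x ts v,
    n - LCS x y <= v, P * v <= (P + Q) * (n - LCS x y),
    size ts <= n %/ b + 1
  & {in ts, forall t, t <= 2000 * (n + 1) * (N + b + 1)}].
Proof.
move=> b_gt0 n_gt0 Q_gt0.
have ck : checkpoint 0 (0 * b) (St (nseq nscal 0) (nseq narr.-1 (fun=> 0)) (fun=> Int 0)).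
  rewrite mul0n; do 19!eexists; split; first reflexivity.
  (* The zero memory is a valid checkpoint: all samples are 0, and L 0 j = 0. *)
  - by move=> u _; split.
  - move=> j _; suff -> : L 0 j = 0 by rewrite !muln0.
    by apply/eqP; rewrite -leqn0 prefixLCS_lel.
  by [].
have lt_0 : 0 * b < n by [].
have [ts [st [ex le_ts ts_gt0]]] := run_update b_gt0 lt_0 ck.
rewrite add0n => le_k.
move=> [o [l [pw [b0 [q0 [N0 [ln [c [j [U [d [s [t [v [G [A [G' [A' [X]]]]]]]]]]]]]]]]]]].
case=> est _ _ /(_ ts_gt0)[le_o [le_V ge_V]].
have eL : LCS x y = L n n by rewrite /prefixLCS !take_oversize ?size_x ?size_y.
have le_L : L n n <= n by apply: prefixLCS_lel.
exists ts, o; rewrite eL; split=> //.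
- exists (memory M st); first by rewrite mem0 -[x]drop0.
  by rewrite onth_mem ?est //.
- lia.
set k := size ts in ge_V le_k *.
(* The precision at (n, n), rewritten in terms of n - L; with 2kP <= qQ it yields the ratio (P + Q)
   / P. *)
have le_q : q * o <= (q + 2 * k) * (n - L n n).
  have e : (q + 2 * k) * n = q * n + k * (n + n) by lia.
  by move: ge_V; rewrite !mulnBr e; have := leq_mul (leqnn q) le_o; lia.
have le_qQ : 2 * k * P <= q * Q.
  apply: (@leq_trans (2 * (n %/ b + 1) * P)).
    by rewrite leq_mul2r leq_mul2l le_k !orbT.
  have := ltn_ceil (2 * (n %/ b + 1) * P) Q_gt0.
  by rewrite -[(_ %/ Q).+1]addn1 => /ltnW.
have q_gt0 : 0 < q by rewrite /q /precision addn1.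
rewrite -(leq_pmul2l q_gt0); move: (n - L n n) le_q => e le_q.
apply: (@leq_trans (P * ((q + 2 * k) * e))).
  by rewrite mulnCA leq_mul2l le_q orbT.
by have := leq_mul le_qQ (leqnn e); lia.
Qed.

End Update.

(** * Asymptotic bounds *)

Section Bounds.
Variables P Q n : nat.
Hypotheses (P_gt0 : 0 < P) (Q_gt0 : 0 < Q).
Let b := bsize P Q n.
Let l := nbits n.

(** The last increment was made because b - 1 passed the test. *)
Lemma bsize_upper : (b.-1) * (b.-1) * Q <= n * P * l.
Proof.
suff main k : (isqrt P Q n k).-1 * (isqrt P Q n k).-1 * Q <= n * P * l by exact: main.
elim: k => //= k IH; rewrite -/l.
case: ltnP => [lt_b|_]; last by rewrite addn0.
by rewrite addn1 /= ltnW.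
Qed.

(** Either the test failed at some round, or all n rounds incremented and b = n, where the
    hypothesis gives the bound. *)
Lemma bsize_lower : P * l <= n * Q -> n * P * l <= b * b * Q.
Proof.
move=> le_n.
have main k : isqrt P Q n k = k \/ n * P * l <= isqrt P Q n k * isqrt P Q n k * Q.
  elim: k => /= [|k IH]; first by left.
  rewrite -/l; case: ltnP => [lt_b|le_b]; last by right; rewrite addn0.
  by case: IH => [->|]; [left; rewrite addn1 | rewrite leqNgt lt_b].
have: b = n \/ n * P * l <= b * b * Q by exact: main.
by case=> // ->; rewrite -!mulnA leq_mul2l le_n orbT.
Qed.

Lemma sqr_le_pow k : k * k <= 2 * 2 ^ k.
Proof.
case: (ltnP k 3) => [|le_k]; first by case: k => [|[|[|]]].
rewrite -(subnK le_k); elim: (k - 3) => // d IH.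
by rewrite addSn expnS; lia.
Qed.

(** The bit length satisfies l^2 <= 8n, so n >= 8 P^2 gives (P l)^2 <= n^2, and similarly for Q. *)
Hypothesis n_big : 100 + 8 * P * P + 8 * Q * Q <= n.

Let l_sqr : l * l <= 8 * n.
Proof. have: 2 ^ l <= n.*2.+1 := pow_bits n n; have := sqr_le_pow l; lia. Qed.

Let le_lP : P * l <= n * Q.
Proof. by rewrite leqNgt; apply/negP => lt_l; nia. Qed.

Let le_lQ : Q * l <= n.
Proof. by rewrite leqNgt; apply/negP => lt_l; nia. Qed.

Lemma big_bsize : n * P * l <= b * b * Q.
Proof. exact: bsize_lower. Qed.

Lemma nbits_le_bsize : l <= b.
Proof.
rewrite leqNgt; apply/negP => lt_b; have := big_bsize; apply/negP; rewrite -ltnNge.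
apply: (@leq_ltn_trans (b * Q * l)).
  by rewrite mulnAC leq_mul2l ltnW ?orbT.
apply: (@leq_trans (n * l)); last by rewrite leq_mul2r leq_pmulr ?orbT.
rewrite ltn_pmul2r; last exact: leq_ltn_trans lt_b.
by apply: leq_trans le_lQ; rewrite mulnC ltn_pmul2l.
Qed.

(** Writing q = e + 1, N = 2 (e l + l + 1) with e l <= 4b and l <= b. The bound on e l comes from b
    (n %/ b + 1) <= 2n and n P l <= b^2 Q. *)
Lemma gsize_le : gsize P Q n <= 12 * b.
Proof.
have n_gt0 : 0 < n by lia.
have b_gt0 : 0 < b by apply: bsize_gt0.
have le_bn : b <= n by apply: isqrt_le.
suff: (2 * (n %/ b + 1) * P %/ Q) * l <= 4 * b.
  by have := nbits_le_bsize; rewrite /gsize /precision -/b -/l mulnDl; lia.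
have le1 := leq_divM (2 * (n %/ b + 1) * P) Q.
have le2 := leq_divM n b.
rewrite -(@leq_pmul2r (b * Q)) ?muln_gt0 ?b_gt0 //.
move: (_ %/ Q) le1 => e; move: (n %/ b) le2 => f le2 le1.
apply: (@leq_trans (4 * (n * P * l))).
  apply: (@leq_trans (b * l * (2 * (f + 1) * P))).
    by have := leq_mul (leqnn (b * l)) le1; lia.
  have le3 : b * (f + 1) <= 2 * n by rewrite mulnDr muln1 mulnC; lia.
  by have := leq_mul (leqnn (2 * l * P)) le3; lia.
by have := big_bsize; lia.
Qed.

Lemma update_time_le k :
  k * (n + 1) * (gsize P Q n + b + 1) <= k * (2 * n) * (14 * b).
Proof.
have b_gt0 : 0 < b by apply: bsize_gt0 => //; lia.
have := gsize_le; rewrite -/b => le_N.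
by apply: leq_mul; [rewrite leq_mul2l; apply/orP; right; lia | lia].
Qed.

End Bounds.

Lemma update_computes (Sigma : eqType) n (x y : n.-tuple Sigma) P Q :
  0 < P -> 0 < Q ->
  let b := bsize P Q n in let N := gsize P Q n in
  exists ts v, [/\ computes y (100 * (n + 1) * (n + 1) * (P + 1) * (Q + 1)) (update P Q)
                     (nscal + narr * (b + N + 1)) x ts v,
    E x y <= v, P * v <= (P + Q) * E x y,
    size ts <= n %/ b + 1
  & {in ts, forall t, t <= 2000 * (n + 1) * (N + b + 1)}].
Proof.
move=> P_gt0 Q_gt0 b N; case: (posnP n) => [n0|n_gt0].
  (* On empty strings no update takes place, and the initial 0 is the exact answer. *)
  have x0 : x = [::] :> seq Sigma by apply: size0nil; rewrite size_tuple.
  have E0 : E x y = 0 by rewrite /E {1}n0.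
  exists [::], 0; rewrite E0 muln0; split=> //.
  by exists (nseq (nscal + narr * (b + N + 1)) (Int 0)); rewrite ?x0 //; constructor.
have le_b : b <= n by apply: isqrt_le.
have le_N : N <= 2 * ((2 * (n + 1) * P + 1) * n + 1).
  rewrite /N /gsize leq_mul2l /= leq_add2r; apply: leq_mul; last exact: bits_le.
  rewrite /precision leq_add2r (leq_trans (leq_div _ _)) //.
  by rewrite leq_mul2r leq_mul2l leq_add2r leq_div !orbT.
set W := (100 * _ * _ * _ * _).
have leW e : e <= 100 * (n + 1) * (n + 1) * (P + 1) -> e <= W.
  by move=> /leq_trans; apply; rewrite leq_pmulr // addn1.
apply: (@computes_update _ n x y P Q W (b + N + 1)); rewrite ?size_tuple //.
- by rewrite addn1.
- by apply: leW; rewrite /nscal /narr; nia.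
- by apply: leW; nia.
- by apply: leW; nia.
- by rewrite /W; nia.
- by apply: leW; nia.
- by rewrite /W; nia.
- exact: bsize_gt0.
Qed.

Lemma leq_mul_pow n k a p q :
  a <= n ^ k -> p <= n -> q <= n -> a * p * q <= n ^ k.+2.
Proof. by move=> le_a le_p le_q; rewrite !expnSr !leq_mul. Qed.

(** * Real estimates and the final theorem *)

Import Order.TTheory GRing.Theory Num.Theory.
Local Open Scope ring_scope.

(** From ln (1 + t) <= t at t = 1 and t = -1/2. *)
Lemma ln2_bounds (R : realType) : 1 / 2 <= ln (2 : R) <= 1.
Proof.
apply/andP; split; last first.
  by have := @le_ln1Dx R 1; rewrite -natr1 addrC; apply; lra.
have : ln (1 + (- 2^-1) : R) <= - 2^-1 by apply: le_ln1Dx; lra.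
have -> : 1 + (- 2^-1) = 2^-1 :> R by lra.
by rewrite lnV ?posrE //; lra.
Qed.

(** Take logarithms in n < 2^l <= 2n + 1 <= n^2; the last inequality is where n >= 3 matters. *)
Lemma nbits_ln (R : realType) n : (3 <= n)%N ->
  ln (n%:R : R) <= (nbits n)%:R <= 4 * ln (n%:R : R).
Proof.
move=> n_ge3; have /andP[ln2_ge ln2_le] := ln2_bounds R.
have n_gt0 : 0 < n%:R :> R by rewrite ltr0n; lia.
have lnX k : ln ((2 ^ k)%:R : R) = k%:R * ln 2.
  by rewrite natrX lnXn // mulr_natl.
have pow_gt0 k : 0 < (2 ^ k)%:R :> R by rewrite ltr0n expn_gt0.
apply/andP; split.
  have : ln (n%:R : R) <= ln ((2 ^ nbits n)%:R : R).
    by rewrite ler_ln ?posrE // ler_nat ltnW // ltn_bits.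
  move/le_trans; apply; rewrite lnX ler_piMr //.
have : ln ((2 ^ nbits n)%:R : R) <= ln ((n%:R : R) ^+ 2).
  rewrite ler_ln ?posrE ?exprn_gt0 // -natrX ler_nat.
  by apply: leq_trans (pow_bits n n) _; nia.
rewrite lnX lnXn //.
have : (nbits n)%:R * (1 / 2) <= (nbits n)%:R * ln 2 :> R by rewrite ler_wpM2l.
lra.
Qed.

Section Asymptotics.
Variables (R : realType) (delta : R) (P Q n : nat).
Hypotheses (delta_gt0 : 0 < delta) (P_gt0 : (0 < P)%N) (Q_gt0 : (0 < Q)%N).
Hypotheses (leQ : Q%:R <= delta * P%:R) (geQ : delta * P%:R <= 2 * Q%:R).
Hypothesis n_big : (100 + 8 * P * P + 8 * Q * Q <= n)%N.
Let b : R := (bsize P Q n)%:R.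
(** All three bounds are functions of Y: space Y, number of updates n / Y, time n Y^2. *)
Let Y := Num.sqrt (n%:R * ln n%:R / delta).

Let n_gt0 : 0 < n%:R :> R. Proof. by rewrite ltr0n; lia. Qed.

Let lnn_ge1 : 1 <= ln n%:R :> R.
Proof.
have /andP[ln2_ge _] := ln2_bounds R.
have : ln ((2 : R) ^+ 2) <= ln n%:R.
  by rewrite ler_ln ?posrE ?exprn_gt0 // -natrX ler_nat; lia.
by rewrite lnXn //; lra.
Qed.

Let lnn_gt0 : 0 < ln n%:R :> R. Proof. exact: lt_le_trans lnn_ge1. Qed.

Let Y_ge0 : 0 <= Y. Proof. exact: sqrtr_ge0. Qed.

Lemma sqr_cell_bound : delta * Y ^+ 2 = n%:R * ln n%:R.
Proof.
rewrite sqr_sqrtr; first by rewrite mulrC divfK // gt_eqF.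
by rewrite ltW // divr_gt0 // mulr_gt0.
Qed.

Lemma cell_bound_ge1 : 1 <= Y.
Proof.
rewrite -[1](@sqrtr1 R) ler_sqrt; last by rewrite ltW // divr_gt0 // mulr_gt0.
rewrite ler_pdivlMr // mul1r.
have n_ge : 2 * Q%:R <= n%:R :> R by rewrite -natrM ler_nat; nia.
have P_ge1 : 1 <= P%:R :> R by rewrite ler1n.
have : delta <= delta * P%:R by rewrite ler_peMr // ltW.
have : n%:R <= n%:R * ln n%:R :> R by rewrite ler_peMr.
by move: geQ n_ge; lra.
Qed.

Let nbitsP : ln (n%:R : R) <= (nbits n)%:R <= 4 * ln (n%:R : R).
Proof. by apply: nbits_ln; lia. Qed.

(** Q Y^2 <= P delta Y^2 = P n ln n <= P n l <= Q b^2. *)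
Lemma bsize_ge : Y <= b.
Proof.
have : (n * P * nbits n)%:R <= (bsize P Q n * bsize P Q n * Q)%:R :> R.
  by rewrite ler_nat big_bsize.
rewrite !natrM -/b => le_b; case/andP: nbitsP => lnl _.
have P_gt0' : 0 < P%:R :> R by rewrite ltr0n.
have Q_gt0' : 0 < Q%:R :> R by rewrite ltr0n.
have b_ge0 : 0 <= b by [].
rewrite -ler_sqr ?nnegrE // -(ler_pM2l Q_gt0').
apply: (@le_trans _ _ (P%:R * (delta * Y ^+ 2))).
  by rewrite mulrA ler_wpM2r ?exprn_ge0 // mulrC.
apply: le_trans (_ : n%:R * P%:R * (nbits n)%:R <= _); last first.
  by rewrite [leRHS]mulrC expr2.
by rewrite sqr_cell_bound mulrCA mulrA ler_wpM2l // mulr_ge0 // ltW.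
Qed.

(** Q (b - 1)^2 <= n P l <= 4 P delta Y^2 <= 8 Q Y^2, so b - 1 <= 3 Y, and Y >= 1 absorbs the
    remaining unit. *)
Lemma bsize_le : b <= 4 * Y.
Proof.
have b_gt0 : (0 < bsize P Q n)%N by apply: bsize_gt0 => //; lia.
have : ((bsize P Q n).-1 * (bsize P Q n).-1 * Q)%:R <= (n * P * nbits n)%:R :> R.
  by rewrite ler_nat bsize_upper.
have b1 : b = (bsize P Q n).-1%:R + 1 by rewrite natr1 prednK.
rewrite !natrM => le_c; case/andP: nbitsP => _ lnl.
have P_gt0' : 0 < P%:R :> R by rewrite ltr0n.
have Q_gt0' : 0 < Q%:R :> R by rewrite ltr0n.
have c_ge0 : 0 <= (bsize P Q n).-1%:R :> R by [].
rewrite b1; move: (_.-1%:R) c_ge0 le_c => c c_ge0 le_c.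
suff : c <= 3 * Y by have := cell_bound_ge1; lra.
rewrite -ler_sqr ?nnegrE ?mulr_ge0 // -(ler_pM2l Q_gt0') mulrC expr2.
apply: (le_trans le_c).
apply: (@le_trans _ _ (4 * P%:R * (delta * Y ^+ 2))).
  rewrite sqr_cell_bound.
  have -> : 4 * P%:R * (n%:R * ln n%:R) = n%:R * P%:R * (4 * ln n%:R) :> R by ring.
  by rewrite ler_wpM2l // mulr_ge0 // ltW.
have -> : 4 * P%:R * (delta * Y ^+ 2) = 4 * (delta * P%:R) * Y ^+ 2 by ring.
have -> : Q%:R * (3 * Y) ^+ 2 = 9 * Q%:R * Y ^+ 2 by ring.
apply: ler_wpM2r; first by rewrite exprn_ge0.
apply: le_trans (_ : 4 * (2 * Q%:R) <= _); first by rewrite ler_wpM2l.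
by rewrite mulrA ler_wpM2r // -natrM ler_nat.
Qed.

End Asymptotics.

(** P is chosen so that delta P >= 2; taking Q as its integer part then loses at most a factor 2. *)
Lemma rational_approx (R : realType) (delta : R) : 0 < delta ->
  exists P Q : nat, [/\ (0 < P)%N, (0 < Q)%N, Q%:R <= delta * P%:R
                      & delta * P%:R <= 2 * Q%:R].
Proof.
move=> delta_gt0; pose P := (Num.truncn (2 / delta)).+1.
have P_ge : 2 <= delta * P%:R.
  rewrite mulrC -ler_pdivrMr // ltW //.
  by case/andP: (truncn_itv (ltW (divr_gt0 (ltr0n R 2) delta_gt0))).
have dP_ge0 : 0 <= delta * P%:R by rewrite mulr_ge0 // ltW.
have /andP[leQ ltQ] := truncn_itv dP_ge0.
exists P, (Num.truncn (delta * P%:R)); split=> //.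
  by rewrite -(@ltr_nat R); rewrite -natr1 in ltQ; lra.
by rewrite -natr1 in ltQ; lra.
Qed.

(** The constants are absolute and the program depends on delta alone, neither on n nor on the
    alphabet. Correctness holds for every n, the asymptotic bounds from n0 on; W <= n ^ c says that
    cells hold integers polynomial in n. *)
Theorem theorem6 (R : realType) :
  exists (C : R) (c : nat),
  forall delta : R, 0 < delta ->
  exists (upd : cmd) (n0 : nat),
  forall n : nat,
  exists S W : nat,
    ((n0 <= n)%N ->
       S%:R <= C * Num.sqrt (n%:R * ln n%:R / delta) /\ (W <= n ^ c)%N) /\
    forall (Sigma : eqType) (x y : n.-tuple Sigma),
    exists (ts : seq nat) (v : nat),
      [/\ computes y W upd S x ts v,
          (E x y)%:R <= (v%:R : R) <= (1 + delta) * (E x y)%:R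
        & (n0 <= n)%N ->
            (size ts)%:R <= C * Num.sqrt (delta * n%:R / ln n%:R) /\
            (forall t : nat, t \in ts ->
               t%:R <= C * (n%:R ^+ 2 * ln n%:R / delta))].
Proof.
(* Generous values: space needs 20 + 78 * 4 Y, time 2000 * 2 * 14 * 4 = 224000 times n Y^2. The
   exponent is 4 for 100 (n + 1)^2, plus one each for P + 1 and Q + 1. *)
exists (1000 * 1000), 6%N => delta delta_gt0.
have [P [Q [P_gt0 Q_gt0 leQ geQ]]] := rational_approx delta_gt0.
exists (update P Q), (100 + 8 * P * P + 8 * Q * Q)%N => n.
set b := bsize P Q n; set N := gsize P Q n.
exists (nscal + narr * (b + N + 1))%N,
  (100 * (n + 1) * (n + 1) * (P + 1) * (Q + 1))%N.
split=> [n_big|Sigma x y].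
  split.
    have := bsize_le delta_gt0 P_gt0 Q_gt0 leQ geQ n_big.
    have := bsize_ge delta_gt0 P_gt0 Q_gt0 leQ geQ n_big.
    have := cell_bound_ge1 delta_gt0 P_gt0 Q_gt0 leQ geQ n_big.
    rewrite -/b; move: (Num.sqrt _) => Y Y_ge1 le_Yb le_bY.
    have le_S : (nscal + narr * (b + N + 1) <= 20 + 78 * b)%N.
      by have := gsize_le P_gt0 Q_gt0 n_big; rewrite /nscal /narr -/b -/N; lia.
    rewrite -(ler_nat R) natrD natrM in le_S; lra.
  have e1 : (100 * (n + 1) * (n + 1) <= n ^ 4)%N.
    apply: (@leq_trans (400 * (n * n))%N).
      have : ((n + 1) * (n + 1) <= (2 * n) * (2 * n))%N by apply: leq_mul; lia.
      lia.
    have -> : (n ^ 4 = (n * n) * (n * n))%N by rewrite !expnS expn0; lia.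
    by rewrite leq_mul2r; apply/orP; right; nia.
  have e2 : (P + 1 <= n)%N by nia.
  have e3 : (Q + 1 <= n)%N by nia.
  exact: leq_mul_pow e1 e2 e3.
have [ts [v [comp_v le_v ge_v le_ts le_t]]] := update_computes x y P_gt0 Q_gt0.
exists ts, v; split=> //.
  rewrite ler_nat le_v /=.
  have P_gt0' : 0 < P%:R :> R by rewrite ltr0n.
  rewrite -(ler_pM2l P_gt0') mulrA.
  rewrite -(ler_nat R) !natrM natrD in ge_v; apply: (le_trans ge_v).
  by rewrite ler_wpM2r // mulrDr mulr1 lerD2l mulrC.
move=> n_big.
have n_gt0 : (0 < n)%N by lia.
have lnn_gt0 : 0 < ln n%:R :> R by rewrite ln_gt0 // ltr1n; lia.
have := bsize_le delta_gt0 P_gt0 Q_gt0 leQ geQ n_big.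
have := bsize_ge delta_gt0 P_gt0 Q_gt0 leQ geQ n_big.
have := cell_bound_ge1 delta_gt0 P_gt0 Q_gt0 leQ geQ n_big.
have := sqr_cell_bound delta_gt0 P_gt0 Q_gt0 leQ geQ n_big.
set Y := Num.sqrt (n%:R * ln n%:R / delta) => eY Y_ge1 le_Yb le_bY.
rewrite -/b in le_Yb le_bY le_t le_ts.
have Y_gt0 : 0 < Y by apply: lt_le_trans Y_ge1.
have nR_gt0 : 0 < n%:R :> R by rewrite ltr0n.
have le_bn : (b <= n)%N by apply: isqrt_le.
have {}eY : Y ^+ 2 = n%:R * ln n%:R / delta by rewrite -eY mulrC mulKf ?gt_eqF.
split.
  have -> : Num.sqrt (delta * n%:R / ln n%:R) = n%:R / Y.
    have -> : delta * n%:R / ln n%:R = (n%:R / Y) ^+ 2.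
      by rewrite expr_div_n eY; field; rewrite !gt_eqF.
    by rewrite sqrtr_sqr ger0_norm // divr_ge0 // ltW.
  (* Absorbs the + 1 of n %/ b + 1. *)
  have le1 : 1 <= n%:R / Y.
    by rewrite ler_pdivlMr // mul1r (le_trans le_Yb) // ler_nat.
  have le2 : (n %/ b)%:R <= n%:R / Y.
    rewrite ler_pdivlMr // (le_trans (ler_wpM2l _ le_Yb)) // -natrM ler_nat.
    exact: leq_divM.
  rewrite -(ler_nat R) natrD in le_ts; lra.
move=> t /le_t /leq_trans/(_ (update_time_le P_gt0 Q_gt0 n_big 2000)).
rewrite -/b -(ler_nat R) !natrM => /le_trans; apply.
have -> : n%:R ^+ 2 * ln n%:R / delta = n%:R * Y ^+ 2 by rewrite eY; ring.
(* An update takes time O(n Y), which is within the announced n Y^2 because Y >= 1. *)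
have le_Y2 : Y <= Y ^+ 2 by rewrite expr2 ler_peMr // ltW.
apply: (@le_trans _ _ (2000 * (2 * n%:R) * (14 * (4 * Y ^+ 2)))).
  rewrite ler_wpM2l ?mulr_ge0 // ler_wpM2l // (le_trans le_bY) //.
  by rewrite ler_wpM2l.
have := mulr_ge0 (ltW nR_gt0) (sqr_ge0 Y); lra.
Qed.
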